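(* Let $S$ be a language whose symbol set is countable, let $X$ be a set of formulas of $S$ and let $\varphi$ be a formula of $S$. If $X \models \varphi$, then $X \vdash_{D_1} \varphi$, where $D_1 = \{R_0, R_{=}, R_{\leftrightarrow}, R_{\Rightarrow}, R_{+}, R_{\mathcal{R}}, R_{\exists\rightarrow}, R_{\downarrow}, R_{\exists\leftarrow}, R_c, R_{\cup}, R_{\neg\neg}\}$.
   Context: Strings: for a set $A$, $A^*$ is the set of finite tuples (strings) over $A$; concatenation is written by juxtaposition and a symbol is identified with the one-letter string. A language $S$ consists of an integer-valued function $\#$ (the arity), an element $\equiv\ \in \operatorname{dom}\#$ with $\#(\equiv)=-2$, and an object $\downarrow\ \notin \operatorname{dom}\#$, such that the set of literals $\{s\in\operatorname{dom}\#:\#(s)=0\}$ is infinite; the symbol set of $S$ is $\operatorname{dom}\#\cup\{\downarrow\}$. Terms of $S$: the smallest set of strings containing the one-letter string $v$ for each literal $v$ and containing $s\,t_1\cdots t_n$ whenever $\#(s)=n>0$ and $t_1,\dots,t_n$ are terms. Formulas: the smallest set containing the atomic formulas $r\,t_1\cdots t_n$ with $\#(r)=-n<0$ and $t_i$ terms, containing $\downarrow\varphi\psi$ for formulas $\varphi,\psi$ (NOR), and containing $v\varphi$ for a literal $v$ and formula $\varphi$ (read ''there exists $v$ with $\varphi$''). Write $\neg\varphi$ for $\downarrow\varphi\varphi$. Simple substitution $\psi[v_1/v_2]$ replaces every occurrence of the literal $v_1$ in the string $\psi$ by the literal $v_2$. Term substitution $\psi[v:=t]$ ($v$ literal, $t$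 term): in an atomic formula, every occurrence of $v$ inside its argument terms is replaced by $t$; $(\downarrow\varphi\psi)[v:=t]=\downarrow\varphi[v:=t]\,\psi[v:=t]$; $(v_1\varphi)[v:=t]=v'\,(\varphi[v_1/v'])[v:=t]$ for some literal $v'$ not equal to $v$ and not occurring in $t$ or $\varphi$. Semantics: an interpretation $i$ with universe a nonempty set $U$ assigns to each $s\in\operatorname{dom}\#$ a map $U^{\#(s)}\to U$ if $\#(s)\ge 0$ (for a literal, an element of $U$) and a map $U^{-\#(s)}\to\{0,1\}$ if $\#(s)<0$. Terms are evaluated by $i(s\,t_1\cdots t_n)=i(s)(i(t_1),\dots,i(t_n))$; an atomic formula $r\,t_1\cdots t_n$ with $r\ne\ \equiv$ evaluates to $i(r)(i(t_1),\dots,i(t_n))$, and $\equiv t_1t_2$ evaluates to $1$ iff $i(t_1)=i(t_2)$; $\downarrow\varphi\psi$ evaluates to $1$ iff both $\varphi,\psi$ evaluate to $0$; $v\varphi$ evaluates to $1$ iff there is $u\in U$ such that $\varphi$ evaluates to $1$ under $i[v\mapsto u]$ (the interpretation equal to $i$ except that it assigns $u$ to $v$). $i\models X$ means every formula in $X$ evaluates to $1$; $X\models\varphi$ means every interpretation of $S$ satisfying $X$ gives $\varphi$ value $1$. Proof theory: a sequent is a pair $(\Gamma,\varphi)$ with $\Gamma$ a finite set of formulas and $\varphi$ a formula. A rule is any map from sets of sequents to sets of sequents; a ruleset is a set of rules. For a ruleset $D$ let $O_D(\Sigma)=\bigcup_{R\in D}R(\Sigma)$ and $O_D^n$ its $n$-th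 iterate ($O_D^0$ the identity). $X\vdash_D\varphi$ iff there are $n\in\mathbb N$ and a finite $\Gamma\subseteq X$ with $(\Gamma,\varphi)\in O_D^n(\emptyset)$. The rules (for $\Sigma$ a set of sequents; $t,t_j,t'_j$ terms, $\varphi,\varphi_j,\psi$ formulas, $v,v_1,v_2$ literals): $R_0(\Sigma)=\{(\{\varphi\},\varphi)\}$; $R_\cup(\Sigma)=\{(\Gamma,\varphi):\exists(\Gamma',\varphi)\in\Sigma,\ \Gamma'\subseteq\Gamma\}$; $R_=(\Sigma)=\{(\emptyset,\equiv tt)\}$; $R_\leftrightarrow(\Sigma)=\{(\{\equiv t_1t_2\},\equiv t_2t_1)\}$; $R_\Rightarrow(\Sigma)=\{(\{\equiv t_1t_2,\equiv t_2t_3\},\equiv t_1t_3)\}$; $R_+(\Sigma)=\{(\{\equiv t_jt'_j:1\le j\le n\},\ \equiv s t_1\cdots t_n\, s t'_1\cdots t'_n):\#(s)=n>0\}$; $R_{\mathcal R}(\Sigma)=\{(\{\equiv t_jt'_j:1\le j\le n\}\cup\{r t_1\cdots t_n\},\ r t'_1\cdots t'_n):\#(r)=-n<0\}$; $R_\downarrow(\Sigma)=\{(\{\downarrow\varphi_1\varphi_2,\downarrow\varphi_3\varphi_4\},\downarrow\varphi_2\varphi_3)\}$; $R_{\exists\rightarrow}(\Sigma)=\{(\{\psi[v:=t]\},v\psi)\}$; $R_{\exists\leftarrow}(\Sigma)=\{(\Gamma'\setminus\{\psi[v_1/v_2]\}\cup\{v_1\psi\},\ \neg{\equiv vv}): (\Gamma'\cup\{\psi[v_1/v_2]\},\neg{\equiv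 vv})\in\Sigma,\ v_2$ occurs in no element of $\Gamma'\cup\{\psi\}\}$; $R_c(\Sigma)=\{(\Gamma,\neg\varphi):\exists\psi,\ (\Gamma\cup\{\varphi\},\psi),(\Gamma\cup\{\varphi\},\neg\psi)\in\Sigma\}$; $R_{\neg\neg}(\Sigma)=\{(\Gamma,\varphi):(\Gamma,\neg\neg\varphi)\in\Sigma\}$. *)

(* Defs.v *)
From mathcomp Require Import all_boot all_order all_algebra.
From mathcomp Require Import boolp classical_sets functions cardinality.

Set Implicit Arguments.
Unset Strict Implicit.
Unset Printing Implicit Defensive.

Local Open Scope classical_set_scope.

(* The carrier of a language is dom #.  Decidable equality on it costs no
   generality, since the metatheory is classical. *)
Record language : Type := Language {
  sym :> eqType;
  arity : sym -> int;
  equality : sym;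
  arity_equality : arity equality = (- 2%:Z)%R;
  literals_infinite : infinite_set [set v : sym | arity v = 0%R]
}.

(* The symbol set is dom # with one object added: [None] is the NOR symbol. *)
Notation symbol S := (option (sym S)).
Notation string S := (seq (symbol S)).

Section Syntax.
Variable S : language.
Implicit Types (s r v : S) (t phi psi : string S).

Definition literal v : Prop := arity v = 0%R.

(* s t_1 ... t_n with n = |#(s)|; also used for atomic formulas. *)
Definition app s (ts : `|arity s|%N.-tuple (string S)) : string S :=
  Some s :: flatten ts.
Definition equ t1 t2 : string S := Some (equality S) :: t1 ++ t2.
Definition nor phi psi : string S := None :: phi ++ psi.
Definition ex v phi : string S := Some v :: phi.
Definition neg phi : string S := nor phi phi.

Inductive is_term : string S -> Prop :=
| term_lit v : literal v -> is_term [:: Some v]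
| term_app s (ts : `|arity s|%N.-tuple (string S)) :
    (0 < arity s)%R -> (forall j, is_term (tnth ts j)) -> is_term (app ts).

Inductive is_formula : string S -> Prop :=
| formula_atom r (ts : `|arity r|%N.-tuple (string S)) :
    (arity r < 0)%R -> (forall j, is_term (tnth ts j)) -> is_formula (app ts)
| formula_nor phi psi :
    is_formula phi -> is_formula psi -> is_formula (nor phi psi)
| formula_ex v phi : literal v -> is_formula phi -> is_formula (ex v phi).

(* psi[v1/v2]: acts on the whole string, quantifier occurrences included. *)
Definition ssubst v1 v2 psi : string S :=
  [seq if x == Some v1 then Some v2 else x | x <- psi].

Definition replace v t psi : string S :=
  flatten [seq if x == Some v then t else [:: x] | x <- psi].

End Syntax.

(* The clause (v1 phi)[v := t] = v' (phi[v1/v'])[v := t] only says "for some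
   literal v'" with v' != v, v' not in t, v' not in phi.  The choice of v' as a
   function of (v1, phi, v, t) is made a parameter. *)
Record fresh_choice (S : language) : Type := FreshChoice {
  fresh :> S -> string S -> S -> string S -> S;
  freshP : forall (v1 : S) (phi : string S) (v : S) (t : string S),
    let v' := fresh v1 phi v t in
    [/\ literal v', v' != v, Some v' \notin t & Some v' \notin phi]
}.

Lemma fresh_choice_inhabited (S : language) : inhabited (fresh_choice S).
Proof.
have fr (l : seq (symbol S)) : exists v : S, literal v /\ Some v \notin l.
  apply: contrapT => nfr; apply: (@literals_infinite S).
  apply: (sub_finite_set _ (finite_seq (pmap id l))) => v /= v0.
  rewrite mem_pmap map_id; apply: contrapT => vl; apply: nfr.
  by exists v; split => //; apply/negP.
have [f fP] := choice fr.
exists; exists (fun _ phi v t => f (Some v :: t ++ phi)) => v1 phi v t /=.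
have [v0] := fP (Some v :: t ++ phi).
by rewrite inE mem_cat !negb_or => /and3P[].
Qed.

Section Deduction.
Variable S : language.
Implicit Types (s r v : S) (t phi psi chi : string S) (Gam : set (string S)).

(* [tsubst fr v t psi psi'] is the graph of psi' = psi[v := t]; it is
   functional by unique readability. *)
Inductive tsubst (fr : fresh_choice S) v t : string S -> string S -> Prop :=
| tsubst_atom r (ts : `|arity r|%N.-tuple (string S)) :
    (arity r < 0)%R -> (forall j, is_term (tnth ts j)) ->
    tsubst fr v t (app ts) (app (map_tuple (replace v t) ts))
| tsubst_nor phi psi phi' psi' :
    tsubst fr v t phi phi' -> tsubst fr v t psi psi' ->
    tsubst fr v t (nor phi psi) (nor phi' psi')
| tsubst_ex v1 phi phi' :
    literal v1 ->
    tsubst fr v t (ssubst v1 (fr v1 phi v t) phi) phi' ->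
    tsubst fr v t (ex v1 phi) (ex (fr v1 phi v t) phi').

Definition is_sequent (q : set (string S) * string S) : Prop :=
  [/\ finite_set q.1, q.1 `<=` @is_formula S & is_formula q.2].

Definition sequent : Type := {q : set (string S) * string S | is_sequent q}.

Definition rule : Type := set sequent -> set sequent.
Definition ruleset : Type := set rule.

(* (Gam, phi) \in Sig *)
Definition contains (Sig : set sequent) Gam phi : Prop :=
  exists2 q, Sig q & sval q = (Gam, phi).

Definition step (D : ruleset) : rule := fun Sig => \bigcup_(R in D) R Sig.

Definition derives (D : ruleset) (X : set (string S)) phi : Prop :=
  exists (n : nat) (Gam : set (string S)),
    [/\ finite_set Gam, Gam `<=` X & contains (iter n (step D) set0) Gam phi].

Definition R_0 : rule := fun Sig =>
  [set q | exists2 phi, is_formula phi & sval q = ([set phi], phi)].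

Definition R_union : rule := fun Sig =>
  [set q | exists Gam Gam' phi,
    [/\ contains Sig Gam' phi, Gam' `<=` Gam & sval q = (Gam, phi)]].

Definition R_eq : rule := fun Sig =>
  [set q | exists2 t, is_term t & sval q = (set0, equ t t)].

Definition R_sym : rule := fun Sig =>
  [set q | exists t1 t2, [/\ is_term t1, is_term t2 &
    sval q = ([set equ t1 t2], equ t2 t1)]].

Definition R_trans : rule := fun Sig =>
  [set q | exists t1 t2 t3, [/\ is_term t1, is_term t2, is_term t3 &
    sval q = ([set equ t1 t2; equ t2 t3], equ t1 t3)]].

Definition R_fun : rule := fun Sig =>
  [set q | exists s (ts ts' : `|arity s|%N.-tuple (string S)),
    [/\ (0 < arity s)%R, forall j, is_term (tnth ts j),
        forall j, is_term (tnth ts' j) &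
        sval q = (range (fun j => equ (tnth ts j) (tnth ts' j)),
                  equ (app ts) (app ts'))]].

Definition R_rel : rule := fun Sig =>
  [set q | exists r (ts ts' : `|arity r|%N.-tuple (string S)),
    [/\ (arity r < 0)%R, forall j, is_term (tnth ts j),
        forall j, is_term (tnth ts' j) &
        sval q = (range (fun j => equ (tnth ts j) (tnth ts' j)) `|`
                  [set app ts], app ts')]].

Definition R_nor : rule := fun Sig =>
  [set q | exists phi1 phi2 phi3 phi4,
    [/\ is_formula phi1, is_formula phi2, is_formula phi3, is_formula phi4 &
        sval q = ([set nor phi1 phi2; nor phi3 phi4], nor phi2 phi3)]].

Definition R_ex_right (fr : fresh_choice S) : rule := fun Sig =>
  [set q | exists v t psi psi',
    [/\ literal v, is_term t, is_formula psi, tsubst fr v t psi psi' &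
        sval q = ([set psi'], ex v psi)]].

Definition R_ex_left : rule := fun Sig =>
  [set q | exists v v1 v2 psi Gam,
    [/\ [/\ literal v, literal v1, literal v2 & is_formula psi],
        contains Sig (Gam `|` [set ssubst v1 v2 psi])
          (neg (equ [:: Some v] [:: Some v])),
        (forall chi, (Gam `|` [set psi]) chi -> Some v2 \notin chi) &
        sval q = ((Gam `\` [set ssubst v1 v2 psi]) `|` [set ex v1 psi],
                  neg (equ [:: Some v] [:: Some v]))]].

Definition R_contr : rule := fun Sig =>
  [set q | exists Gam phi psi,
    [/\ is_formula phi, is_formula psi,
        contains Sig (Gam `|` [set phi]) psi,
        contains Sig (Gam `|` [set phi]) (neg psi) &
        sval q = (Gam, neg phi)]].

Definition R_negneg : rule := fun Sig =>
  [set q | exists Gam phi,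
    [/\ is_formula phi, contains Sig Gam (neg (neg phi)) &
        sval q = (Gam, phi)]].

Definition D_1 (fr : fresh_choice S) : ruleset :=
  [set R_0; R_eq; R_sym; R_trans; R_fun; R_rel; R_ex_right fr; R_nor;
       R_ex_left; R_contr; R_union; R_negneg].

End Deduction.

(* U^n is the type of n-tuples.  Both fields are total on the symbols: [fn] is
   only ever used where # >= 0 and [rel] where # < 0. *)
Record interp (S : language) : Type := Interp {
  univ : Type;
  univ_nonempty : inhabited univ;
  fn : forall s : S, `|arity s|%N.-tuple univ -> univ;
  rel : forall s : S, `|arity s|%N.-tuple univ -> bool
}.

Section Semantics.
Variable S : language.

Definition update (i : interp S) (v : S) (u : univ i) : interp S :=
  Interp (univ_nonempty i)
    (fun s us => if s == v then u else fn us) (@rel S i).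

(* [teval i t u] is the graph of i(t) = u; a literal is the case of the empty
   tuple. *)
Inductive teval (i : interp S) : string S -> univ i -> Prop :=
| teval_app (s : S) (ts : `|arity s|%N.-tuple (string S))
    (us : `|arity s|%N.-tuple (univ i)) :
    (0 <= arity s)%R -> (forall j, teval (tnth ts j) (tnth us j)) ->
    teval (app ts) (fn us).

(* [feval i phi b] is the graph of i(phi) = b. *)
Inductive feval : interp S -> string S -> bool -> Prop :=
| feval_equ i t1 t2 (u1 u2 : univ i) :
    teval t1 u1 -> teval t2 u2 -> feval i (equ t1 t2) `[< u1 = u2 >]
| feval_rel i (r : S) (ts : `|arity r|%N.-tuple (string S))
    (us : `|arity r|%N.-tuple (univ i)) :
    (arity r < 0)%R -> r <> equality S ->
    (forall j, teval (tnth ts j) (tnth us j)) ->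
    feval i (app ts) (rel us)
| feval_nor i phi psi b c :
    feval i phi b -> feval i psi c -> feval i (nor phi psi) (~~ b && ~~ c)
| feval_ex i (v : S) phi (f : univ i -> bool) :
    literal v -> (forall u, feval (update v u) phi (f u)) ->
    feval i (ex v phi) `[< exists u, f u = true >].

Definition models (i : interp S) (X : set (string S)) : Prop :=
  forall phi, X phi -> feval i phi true.

Definition entails (X : set (string S)) (phi : string S) : Prop :=
  forall i : interp S, models i X -> feval i phi true.

End Semantics.

(* Main.v *)
Require Import Defs.
From mathcomp Require Import all_boot all_order all_algebra.
From mathcomp Require Import boolp classical_sets functions cardinality.

Set Implicit Arguments.
Unset Strict Implicit.
Unset Printing Implicit Defensive.

Import Order.TTheory GRing.Theory Num.Theory Defs.
Local Open Scope classical_set_scope.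

(* If X does not derive phi, then Y = X + (not phi) is consistent.  Henkin's
   construction gives a model of a consistent set of formulas provided that
   infinitely many literals are unused in it: they serve as witnesses.  Since Y
   may use every literal, Y is first replaced by its image under an injective
   renaming f of the literals that misses infinitely many of them.  Derivations
   cannot be renamed directly, the choice of bound variables in [v := t] being
   arbitrary, so the consistency of f(Y) is obtained semantically: every finite
   part of Y has a model by Henkin's construction, hence so has every finite
   part of f(Y), which is therefore consistent by soundness.  A model of f(Y)
   is turned into a model of Y by composing the values of literals with f. *)

(** * Unique readability *)

Lemma forall_tnthP (T : eqType) n (ts : n.-tuple T) (P : T -> Prop) :
  (forall j, P (tnth ts j)) <-> (forall x, x \in ts -> P x).
Proof.
split=> [Pts x /tnthP[j ->] // | Pts j]; exact/Pts/mem_tnth.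
Qed.

(** A property of one word [x] against all words of [P], so that it can be proved by induction on
    how [x] was built. *)
Definition prefix_code (A : eqType) (P : seq A -> Prop) (x : seq A) :=
  forall y r r', P y -> x ++ r = y ++ r' -> x = y /\ r = r'.

Lemma prefix_code_flatten (A : eqType) (P : seq A -> Prop) (l l' : seq (seq A)) r r' :
  size l = size l' -> (forall x, x \in l -> prefix_code P x) ->
  (forall x, x \in l' -> P x) -> flatten l ++ r = flatten l' ++ r' ->
  l = l' /\ r = r'.
Proof.
elim: l l' => [|x l IHl] [|y l'] //= [sz] codel Pl'; rewrite -!catA => eq_cat.
have [|-> eq_cat'] := codel x (mem_head _ _) y _ _ _ eq_cat.
  exact/Pl'/mem_head.
have [||->->] // := IHl l' sz _ _ eq_cat' => z zl.
  by apply: codel; rewrite inE zl orbT.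
by apply: Pl'; rewrite inE zl orbT.
Qed.

Section Readability.
Variable S : language.
Implicit Types (s r v : S) (t phi psi : string S).

Lemma prefix_code_tuple n (ts ts' : n.-tuple (string S)) (x x' : string S)
    (P : string S -> Prop) :
  (forall j, prefix_code P (tnth ts j)) -> (forall j, P (tnth ts' j)) ->
  flatten ts ++ x = flatten ts' ++ x' -> ts = ts' /\ x = x'.
Proof.
move=> /(forall_tnthP _ (prefix_code P)) tsP /(forall_tnthP _ P) ts'P.
move=> /(prefix_code_flatten _ tsP ts'P)[|eqts ->]; first by rewrite !size_tuple.
by split=> //; apply: val_inj.
Qed.

(** The first symbol decides: a literal is a whole term, and a positive arity fixes the number of
    arguments, which are then split off one by one. *)
Lemma term_prefix t : is_term t -> prefix_code (@is_term S) t.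
Proof.
elim=> [v v0 y r r'|s ts s0 _ IH y r r'].
  by case=> [v' v'0 [-> ->] //|s ts s0 _ [eqv _]]; rewrite /literal eqv in v0; rewrite v0 in s0.
case=> [v v0 [eqs _]|s' ts' s'0 ts't [eqs]].
  by rewrite /literal -eqs in v0; rewrite v0 in s0.
case: _ / eqs in ts' s'0 ts't *.
by move=> /(prefix_code_tuple IH ts't)[-> ->].
Qed.

Lemma app_inj s (ts ts' : `|arity s|%N.-tuple (string S)) :
  (forall j, is_term (tnth ts j)) -> (forall j, is_term (tnth ts' j)) ->
  app ts = app ts' -> ts = ts'.
Proof.
move=> tst ts't [/(congr1 (cat^~ [::]))] eq_flat.
by have [] := prefix_code_tuple (fun j => term_prefix (tst j)) ts't eq_flat.
Qed.

Lemma equ_inj t1 t2 t1' t2' : is_term t1 -> is_term t1' ->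
  equ t1 t2 = equ t1' t2' -> t1 = t1' /\ t2 = t2'.
Proof. by move=> t1t t1't [/(term_prefix t1t)]; apply. Qed.

(** The three kinds of formula start with different symbols: one of negative arity, [None], or a
    literal. *)
Lemma formula_prefix phi : is_formula phi -> prefix_code (@is_formula S) phi.
Proof.
elim=> [r ts r0 tst|phi1 phi2 _ IH1 _ IH2|v phi1 v0 _ IH1] y x x'.
- case=> [r' ts' r'0 ts't [eqr]|//|v psi v0 _ [eqr _]]; last first.
    by rewrite /literal -eqr in v0; rewrite v0 in r0.
  case: _ / eqr in ts' r'0 ts't *.
  by move=> /(prefix_code_tuple (fun j => term_prefix (tst j)) ts't)[-> ->].
- case=> // psi1 psi2 f1 f2 []; rewrite -!catA => /(IH1 _ _ _ f1)[->].
  by move=> /(IH2 _ _ _ f2)[-> ->].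
- case=> // [r' ts' r'0 ts't [eqr _]|v' psi v'0 f1 [-> /(IH1 _ _ _ f1)[-> ->]] //].
  by rewrite /literal eqr in v0; rewrite v0 in r'0.
Qed.

Lemma nor_inj phi psi phi' psi' : is_formula phi -> is_formula phi' ->
  nor phi psi = nor phi' psi' -> phi = phi' /\ psi = psi'.
Proof. by move=> f f' [/(formula_prefix f)]; apply. Qed.

Lemma absz_arity_equality : `|arity (equality S)|%N = 2.
Proof. by rewrite arity_equality. Qed.

Lemma equality_lt0 : (arity (equality S) < 0)%R.
Proof. by rewrite arity_equality. Qed.

(** [equ] joins two strings, whereas [formula_atom] expects a tuple; this lemma and [app_equ] pass
    between the two forms. *)
Lemma equ_app t1 t2 :
  exists2 ts : `|arity (equality S)|%N.-tuple (string S),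
    tval ts = [:: t1; t2] & equ t1 t2 = app ts.
Proof.
have sz : size [:: t1; t2] == `|arity (equality S)|%N.
  by rewrite absz_arity_equality.
by exists (Tuple sz) => //; rewrite /app /= cats0.
Qed.

Lemma app_equ (ts : `|arity (equality S)|%N.-tuple (string S)) :
  (forall j, is_term (tnth ts j)) ->
  exists t1 t2, [/\ is_term t1, is_term t2, tval ts = [:: t1; t2] & app ts = equ t1 t2].
Proof.
move=> /forall_tnthP tst.
have {}tst x : x \in tval ts -> is_term x by apply: tst.
have: size (tval ts) = 2 by rewrite size_tuple absz_arity_equality.
rewrite /app.
case: (tval ts) tst => [|t1 [|t2 [|]]] //= tst _.
exists t1, t2; split => //; last by rewrite /= cats0.
  by apply: tst; rewrite inE eqxx.
by apply: tst; rewrite !inE eqxx orbT.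
Qed.

Lemma formula_equ t1 t2 : is_term t1 -> is_term t2 -> is_formula (equ t1 t2).
Proof.
move=> t1t t2t; have [ts tsE ->] := equ_app t1 t2.
apply: formula_atom; first exact: equality_lt0.
apply/forall_tnthP => t; rewrite -[t \in ts]/(t \in tval ts) tsE !inE.
by case/orP => /eqP ->.
Qed.

Lemma formula_neg phi : is_formula phi -> is_formula (neg phi).
Proof. by move=> f; apply: formula_nor. Qed.

Lemma formula_exP v phi : literal v -> is_formula (ex v phi) -> is_formula phi.
Proof.
move=> v0 g; case: {-2}_ / g (erefl (ex v phi)) => // [r ts r0 _ [eqr _]|w psi _ f [_ <-] //].
by rewrite /literal -eqr in v0; rewrite v0 in r0.
Qed.

End Readability.

(** * Semantics as functions *)

Section Evaluation.
Variable S : language.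
Implicit Types (i : interp S) (s r v : S) (t phi psi : string S).

Definition some_point i : univ i :=
  projT1 (cid (let: inhabits u := univ_nonempty i in ex_intro (fun=> True) u I)).

Definition value i t : univ i :=
  if pselect (exists u, @teval S i t u) is left e then projT1 (cid e)
  else some_point i.

Definition sat i phi := feval i phi true.

Lemma app_literal v (ts : `|arity v|%N.-tuple (string S)) :
  literal v -> app ts = [:: Some v].
Proof.
move=> v0; have : size (tval ts) = 0 by rewrite size_tuple v0.
by rewrite /app; case: (tval ts).
Qed.

Lemma teval_term i t u : @teval S i t u -> is_term t.
Proof.
elim=> {t u} s ts us; rewrite le_eqVlt => /orP[/eqP s0 _ _|s_gt0 _ tst].
  by rewrite app_literal //; apply: term_lit.
exact: term_app.
Qed.

Lemma teval_inj i t u u' : @teval S i t u -> teval t u' -> u = u'.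
Proof.
move=> tu; elim: tu u' => {t u} s ts us s0 tsus IH u' tu'.
(* The second evaluation is inverted by hand, so that the head symbols can be identified together
   with the tuples typed over them. *)
have [s' [ts' [us' [ts'us' [eqs eq_flat] ->]]]] : exists s' (ts' : `|arity s'|%N.-tuple _)
    us', [/\ forall j, @teval S i (tnth ts' j) (tnth us' j), app ts = app ts' & u' = fn us'].
  by case: tu' => s' ts' us' _ ts'us'; exists s', ts', us'.
case: _ / eqs in ts' us' ts'us' eq_flat *.
have eqts : ts = ts'.
  have tst j : is_term (tnth ts j) by exact: teval_term (tsus j).
  have ts't j : is_term (tnth ts' j) by exact: teval_term (ts'us' j).
  by apply: app_inj => //; rewrite /app eq_flat.
case: _ / eqts in ts'us' *; congr (fn _).
by apply: eq_from_tnth => j; apply: IH.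
Qed.

Lemma value_eq i t u : teval t u -> value i t = u.
Proof.
rewrite /value; case: pselect => [e|ne] tu; last by case: ne; exists u.
exact: teval_inj (projT2 (cid e)) tu.
Qed.

Lemma valueP i t : is_term t -> teval t (value i t).
Proof.
move=> tt; suff [u tu] : exists u, @teval S i t u by rewrite (value_eq tu).
elim: tt => {t} [v v0|s ts s0 tst IH].
  have ts : `|arity v|%N.-tuple (string S) by exact: nseq_tuple [::].
  have us : `|arity v|%N.-tuple (univ i) by exact: nseq_tuple (some_point i).
  exists (fn us); rewrite -(app_literal ts v0); constructor; first by rewrite v0.
  by case=> j jlt; exfalso; rewrite v0 in jlt.
have [f fP] := choice IH.
exists (fn (mktuple f)); constructor; first exact: ltW.
by move=> j; rewrite tnth_mktuple.
Qed.

Lemma value_app i s (ts : `|arity s|%N.-tuple (string S)) : (0 <= arity s)%R ->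
  (forall j, is_term (tnth ts j)) -> value i (app ts) = fn (map_tuple (value i) ts).
Proof.
move=> s0 tst; apply: value_eq; constructor=> // j.
by rewrite tnth_map; apply: valueP.
Qed.

(** Inversion with [i] kept fixed: only equations between strings and booleans remain, none between
    objects over different interpretations. *)
Lemma feval_inv i phi b : feval i phi b ->
  [\/ exists t1 t2, [/\ is_term t1, is_term t2, phi = equ t1 t2 &
         b = `[< value i t1 = value i t2 >]],
      exists r (ts : `|arity r|%N.-tuple (string S)),
       [/\ (arity r < 0)%R, r <> equality S, forall j, is_term (tnth ts j),
         phi = app ts & b = rel (map_tuple (value i) ts)],
      exists phi1 phi2 b1 b2, [/\ feval i phi1 b1, feval i phi2 b2,
         phi = nor phi1 phi2 & b = ~~ b1 && ~~ b2] |
      exists v psi (f : univ i -> bool), [/\ literal v,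
         forall u, feval (update v u) psi (f u), phi = ex v psi &
         b = `[< exists u, f u = true >]]].
Proof.
case=> {i phi b} [i t1 t2 u1 u2 tu1 tu2|i r ts us r0 rne tsus|i phi psi b c|i v phi f v0 fP].
- apply: Or41; exists t1, t2; rewrite (value_eq tu1) (value_eq tu2).
  by split=> //; [apply: teval_term tu1|apply: teval_term tu2].
- apply: Or42; exists r, ts; split=> // [j|]; first exact: teval_term (tsus j).
  congr (rel _); apply: eq_from_tnth => j; rewrite tnth_map; apply/esym/value_eq/tsus.
- by move=> fb fc; apply: Or43; exists phi, psi, b, c.
- by apply: Or44; exists v, phi, f.
Qed.

Lemma feval_formula i phi b : feval i phi b -> is_formula phi.
Proof.
elim=> {i phi b} [i t1 t2 u1 u2 tu1 tu2|i r ts us r0 rne tsus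
  |i phi psi b c _ fphi _ fpsi|i v phi f v0 _ fphi].
- by apply: formula_equ; [apply: teval_term tu1|apply: teval_term tu2].
- by apply: formula_atom => // j; apply: teval_term (tsus j).
- exact: formula_nor.
- exact/formula_ex/(fphi (some_point i)).
Qed.

Lemma literal_neg s : literal s -> (arity s < 0)%R -> False.
Proof. by rewrite /literal => ->. Qed.

Lemma feval_inj i phi b c : feval i phi b -> feval i phi c -> b = c.
Proof.
move=> H; elim: H c => {i phi b} [i t1 t2 u1 u2 tu1 tu2|i r ts us r0 rne tsus
  |i phi psi b b' fphi IHphi fpsi IHpsi|i v phi f v0 fP IH] c.
- case/feval_inv=> [[t1' [t2' [t1't _ eqE ->]]]
    |[r [ts [_ rne _ [eqr _] _]]]|[? [? [? [? []]]]] //|[v [? [? [v0 _ [eqv _]]]]]].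
  + have [<- <-] := equ_inj (teval_term tu1) t1't eqE.
    by rewrite (value_eq tu1) (value_eq tu2).
  + by case: rne.
  + by case: (literal_neg v0); rewrite -eqv equality_lt0.
- case/feval_inv=> [[t1' [t2' [_ _ [eqr _] _]]]
    |[r' [ts' [_ _ ts't [eqr]]]]|[? [? [? [? []]]]] //|[v [? [? [v0 _ [eqv _]]]]]].
  + by case: rne.
  + case: _ / eqr in ts' ts't * => eq_flat ->.
    have eqts : ts = ts'.
      have tst j : is_term (tnth ts j) by exact: teval_term (tsus j).
      by apply: app_inj => //; rewrite /app eq_flat.
    case: _ / eqts in eq_flat ts't *; congr (rel _).
    by apply: eq_from_tnth => j; rewrite tnth_map; apply/esym/value_eq/tsus.
  + by case: (literal_neg v0); rewrite -eqv.
- case/feval_inv=> [[? [? []]] //|[? [? []]] //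
    |[phi1 [phi2 [b1 [b2 [f1 f2 eqphi ->]]]]]|[? [? [? []]]] //].
  have [eq1 eq2] := nor_inj (feval_formula fphi) (feval_formula f1) eqphi.
  by rewrite -eq1 in f1; rewrite -eq2 in f2; rewrite (IHphi _ f1) (IHpsi _ f2).
- case/feval_inv=> [[t1 [t2 [_ _ [eqv _] _]]]|[r [ts [r0 _ _ [eqv _] _]]]
    |[? [? [? [? []]]]] //|[v' [phi' [f' [v'0 f'P [eqv eqphi] ->]]]]].
  + by case: (literal_neg v0); rewrite eqv equality_lt0.
  + by case: (literal_neg v0); rewrite eqv.
  + suff -> : f = f' by [].
    by apply/funext => u; apply: IH; rewrite eqv eqphi.
Qed.

(** Identity atoms have an evaluation clause of their own, so evaluating an atom starts with this
    split. *)
Lemma atom_cases r (ts : `|arity r|%N.-tuple (string S)) :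
  (forall j, is_term (tnth ts j)) ->
  r <> equality S \/
  exists t1 t2, [/\ is_term t1, is_term t2 & app ts = equ t1 t2].
Proof.
move=> tst; have [eqr|] := pselect (r = equality S); last by left.
right; case: _ / (esym eqr) in ts tst *.
by have [t1 [t2 [? ? _ ->]]] := app_equ tst; exists t1, t2.
Qed.

Lemma feval_total i phi : is_formula phi -> exists b, feval i phi b.
Proof.
move=> fphi; elim: fphi i => {phi} [r ts r0 tst|phi psi _ IH1 _ IH2|v phi v0 _ IH] i.
- have [rne|[t1 [t2 [t1t t2t ->]]]] := atom_cases tst; last first.
    exists `[< value i t1 = value i t2 >]; exact: feval_equ (valueP i t1t) (valueP i t2t).
  exists (rel (map_tuple (value i) ts)); apply: feval_rel => // j.
  by rewrite tnth_map; apply: valueP.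
- have [[b ?] [c ?]] := (IH1 i, IH2 i).
  by exists (~~ b && ~~ c); apply: feval_nor.
- have [f fP] := choice (fun u : univ i => IH (update v u)).
  by exists `[< exists u, f u = true >]; exact: feval_ex v0 fP.
Qed.

Lemma feval_sat i phi : is_formula phi -> feval i phi `[< sat i phi >].
Proof.
move=> /(feval_total i)[b fb]; case: asboolP => // nsat.
by case: b fb => // /nsat.
Qed.

Lemma sat_equ i t1 t2 : is_term t1 -> is_term t2 ->
  sat i (equ t1 t2) <-> value i t1 = value i t2.
Proof.
move=> t1t t2t; have H := feval_equ (valueP i t1t) (valueP i t2t).
split=> [/feval_inj/(_ H)/esym/asboolP //|eqv].
by move: H; rewrite /sat asboolT.
Qed.

Lemma sat_rel i r (ts : `|arity r|%N.-tuple (string S)) : (arity r < 0)%R ->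
  r <> equality S -> (forall j, is_term (tnth ts j)) ->
  sat i (app ts) <-> rel (map_tuple (value i) ts).
Proof.
move=> r0 rne tst.
have H : feval i (app ts) (rel (map_tuple (value i) ts)).
  by apply: feval_rel => // j; rewrite tnth_map; apply: valueP.
split=> [/feval_inj/(_ H) <- //|relT].
by move: H; rewrite /sat relT.
Qed.

Lemma sat_nor i phi psi : is_formula phi -> is_formula psi ->
  sat i (nor phi psi) <-> ~ sat i phi /\ ~ sat i psi.
Proof.
move=> fphi fpsi; have H := feval_nor (feval_sat i fphi) (feval_sat i fpsi).
split=> [/feval_inj/(_ H)/esym/andP[/asboolPn ? /asboolPn ?] //|[n1 n2]].
by move: H; rewrite (asboolF n1) (asboolF n2).
Qed.

Lemma sat_neg i phi : is_formula phi -> sat i (neg phi) <-> ~ sat i phi.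
Proof. by move=> f; rewrite sat_nor //; split=> [[]|]. Qed.

Lemma sat_ex i v phi : literal v -> is_formula phi ->
  sat i (ex v phi) <-> exists u : univ i, sat (update v u) phi.
Proof.
move=> v0 fphi.
have H := feval_ex v0 (fun u : univ i => feval_sat (update v u) fphi).
split=> [/feval_inj/(_ H)/esym/asboolP[u /asboolP su]|[u su]]; first by exists u.
by move: H; rewrite /sat asboolT //; exists u; apply/asboolP.
Qed.

End Evaluation.

(** * Renaming and substitution *)

Section Substitution.
Variable S : language.
Implicit Types (s r v : S) (t phi psi : string S).

(* [rank n phi] bounds the nesting depth of connectives and quantifiers: unlike
   the length, this is preserved by [v := t]. *)
Inductive rank : nat -> string S -> Prop :=
| rank_atom n r (ts : `|arity r|%N.-tuple (string S)) :
    (arity r < 0)%R -> (forall j, is_term (tnth ts j)) -> rank n (app ts)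
| rank_nor n phi psi : rank n phi -> rank n psi -> rank n.+1 (nor phi psi)
| rank_ex n v phi : literal v -> rank n phi -> rank n.+1 (ex v phi).

Lemma rank_formula n phi : rank n phi -> is_formula phi.
Proof.
by elim=> *; [apply: formula_atom|apply: formula_nor|apply: formula_ex].
Qed.

Lemma rank_leq m n phi : (m <= n)%N -> rank m phi -> rank n phi.
Proof.
move=> le_mn rm; elim: rm n le_mn => {m phi} [m r ts r0 tst n _|m phi psi _ IH1 _ IH2 [|n] //= lt_mn
  |m v phi v0 _ IH [|n] //= lt_mn].
- exact: rank_atom.
- by apply: rank_nor; [apply: IH1|apply: IH2].
- by apply: rank_ex => //; apply: IH.
Qed.

Lemma formula_rank phi : is_formula phi -> exists n, rank n phi.
Proof.
elim=> [r ts r0 tst|{}phi psi _ [m r1] _ [n r2]|v psi v0 _ [n r1]].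
- by exists 0; apply: rank_atom.
- exists (maxn m n).+1; apply: rank_nor.
    exact: rank_leq (leq_maxl _ _) r1.
  exact: rank_leq (leq_maxr _ _) r2.
- by exists n.+1; apply: rank_ex.
Qed.

Definition rename (f : S -> S) phi : string S := map (omap f) phi.

Definition literal_renaming (f : S -> S) : Prop :=
  (forall v, literal v -> literal (f v)) /\ (forall s, ~ literal s -> f s = s).

(** Presents [ssubst] as a renaming. It identifies [v] with [w], so it is injective only on the
    symbols of a formula without [w]. *)
Definition redirect v w : S -> S := fun s => if s == v then w else s.

Lemma redirect_renaming v w : literal v -> literal w -> literal_renaming (redirect v w).
Proof.
move=> v0 w0; rewrite /redirect; split=> s; case: eqP => // ->.
by [].
Qed.

Lemma ssubst_rename v w phi : ssubst v w phi = rename (redirect v w) phi.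
Proof.
rewrite /ssubst /rename /redirect; apply: eq_map => -[s|] //=.
by rewrite (inj_eq Some_inj); case: eqP.
Qed.

Section Rename.
Variables (f : S -> S) (f_ren : literal_renaming f).

Lemma not_literal_pos s : (0 < arity s)%R -> ~ literal s.
Proof. by move=> s0 l; rewrite l in s0. Qed.

Lemma not_literal_neg s : (arity s < 0)%R -> ~ literal s.
Proof. by move=> s0 l; rewrite l in s0. Qed.

Lemma rename_app s (ts : `|arity s|%N.-tuple (string S)) : ~ literal s ->
  rename f (app ts) = app (map_tuple (rename f) ts).
Proof. by move=> ns; rewrite /rename /app /= map_flatten f_ren.2. Qed.

Lemma rename_nor phi psi : rename f (nor phi psi) = nor (rename f phi) (rename f psi).
Proof. by rewrite /rename /= map_cat. Qed.

Lemma rename_term t : is_term t -> is_term (rename f t).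
Proof.
elim=> [v v0|s ts s0 _ IH]; first exact/term_lit/f_ren.1.
rewrite rename_app; last exact: not_literal_pos.
by apply: term_app => // j; rewrite tnth_map.
Qed.

Lemma rank_rename n phi : rank n phi -> rank n (rename f phi).
Proof.
elim=> {n phi} [n r ts r0 tst|n phi psi _ IH1 _ IH2|n v phi v0 _ IH].
- rewrite rename_app; last exact: not_literal_neg.
  by apply: rank_atom => // j; rewrite tnth_map; apply: rename_term.
- by rewrite rename_nor; apply: rank_nor.
- by apply: rank_ex => //; apply: f_ren.1.
Qed.

Lemma rename_formula phi : is_formula phi -> is_formula (rename f phi).
Proof. by move=> /formula_rank[n /rank_rename/rank_formula]. Qed.

End Rename.

Lemma rank_ssubst n v w phi : literal v -> literal w ->
  rank n phi -> rank n (ssubst v w phi).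
Proof.
move=> v0 w0; rewrite ssubst_rename.
exact/rank_rename/redirect_renaming.
Qed.

Lemma ssubst_formula v w phi : literal v -> literal w ->
  is_formula phi -> is_formula (ssubst v w phi).
Proof.
move=> v0 w0; rewrite ssubst_rename.
exact/rename_formula/redirect_renaming.
Qed.

(** * Term substitution *)

Lemma replace_cat v t p q : replace v t (p ++ q) = replace v t p ++ replace v t q.
Proof. by rewrite /replace map_cat flatten_cat. Qed.

Lemma replace_app v t s (ts : `|arity s|%N.-tuple (string S)) : s != v ->
  replace v t (app ts) = app (map_tuple (replace v t) ts).
Proof.
move=> /negPf snev; rewrite /app -cat1s replace_cat /= {1}/replace /= (inj_eq Some_inj) snev.
congr cons; rewrite /= -/(tval _).
by elim: (tval ts) => //= x l IH; rewrite replace_cat IH.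
Qed.

Lemma replace_lit v t w : replace v t [:: Some w] = if w == v then t else [:: Some w].
Proof. by rewrite /replace /= (inj_eq Some_inj) cats0. Qed.

Lemma replace_term v t t' : literal v -> is_term t -> is_term t' -> is_term (replace v t t').
Proof.
move=> v0 tt; elim=> [w w0|s ts s0 _ IH].
  by rewrite replace_lit; case: eqP => // _; apply: term_lit.
rewrite replace_app; first by apply: term_app => // j; rewrite tnth_map.
by apply/eqP => eqs; rewrite eqs v0 in s0.
Qed.

Variable fr : fresh_choice S.

Lemma tsubst_formula v t phi phi' : literal v -> is_term t -> tsubst fr v t phi phi' ->
  is_formula phi'.
Proof.
move=> v0 tt; elim=> {phi phi'} [r ts r0 tst|phi psi phi' psi' _ ? _ ?|v1 phi phi' v10 _ ?].
- by apply: formula_atom => // j; rewrite tnth_map; apply: replace_term.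
- exact: formula_nor.
- by apply: formula_ex => //; case: (freshP fr v1 phi v t).
Qed.

(** Under a quantifier the recursion continues with the renamed body, which is no subformula but has
    the same rank bound; hence the induction on rank. *)
Lemma tsubst_total n v t phi : literal v -> is_term t -> rank n phi ->
  exists2 phi', tsubst fr v t phi phi' & rank n phi'.
Proof.
move=> v0 tt; have [m] := ubnP n; elim: m n phi => // m IH n phi ltnm rphi.
case: rphi ltnm => {n phi} [n r ts r0 tst _|n phi psi r1 r2|n v1 phi v10 r1]; rewrite ?ltnS.
- exists (app (map_tuple (replace v t) ts)); first exact: tsubst_atom.
  by apply: rank_atom => // j; rewrite tnth_map; apply: replace_term.
- move=> ltnm; have [[p ? ?] [q ? ?]] := (IH _ _ ltnm r1, IH _ _ ltnm r2).
  by exists (nor p q); [apply: tsubst_nor|apply: rank_nor].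
- move=> ltnm; have [w0 _ _ _] := freshP fr v1 phi v t.
  have [p ? ?] := IH _ _ ltnm (rank_ssubst v10 w0 r1).
  by exists (ex (fr v1 phi v t) p); [apply: tsubst_ex|apply: rank_ex].
Qed.

Lemma ssubstK v w phi : Some w \notin phi -> ssubst w v (ssubst v w phi) = phi.
Proof.
move=> wphi; rewrite /ssubst -map_comp -[RHS]map_id; apply/eq_in_map => x xphi /=.
case: (eqVneq x (Some v)) => [->|_]; first by rewrite eqxx.
by case: eqP => // eqx; rewrite -eqx xphi in wphi.
Qed.

(** [tsubst_ex] speaks only of the renamed body; as the new literal is fresh, renaming it back
    recovers the body itself. *)
Lemma tsubst_source v t phi phi' : tsubst fr v t phi phi' -> is_formula phi.
Proof.
elim=> {phi phi'} [r ts r0 tst|phi psi phi' psi' _ ? _ ?|v1 phi phi' v10 _ fphi].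
- exact: formula_atom.
- exact: formula_nor.
- have [w0 _ _ wphi] := freshP fr v1 phi v t.
  by apply: formula_ex => //; rewrite -(ssubstK v1 wphi); apply: ssubst_formula.
Qed.

(** * Environments and substitution lemmas *)

Section Environments.
Variable i : interp S.
Local Notation U := (univ i).
Implicit Types e : S -> U.

(** The values of the literals are split off from the interpretation, so that updates change only
    the environment and the universe stays [univ i]. *)
Definition with_env e : interp S :=
  Interp (univ_nonempty i)
    (fun s us => if arity s == 0%R then e s else fn us) (@Defs.rel S i).

Definition upd e v (u : U) : S -> U := fun s => if s == v then u else e s.

Lemma update_with_env e v u : literal v ->
  @update S (with_env e) v u = with_env (upd e v u).
Proof.
move=> v0; rewrite /update /with_env /=; congr Interp.
apply/functional_extensionality_dep => s; apply/funext => us; rewrite /upd.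
by case: (s =P v) => // eqs; rewrite ifT // eqs v0.
Qed.

Definition term_val e t : U := value (with_env e) t.
Definition Sat e phi := sat (with_env e) phi.

Lemma term_val_lit e v : literal v -> term_val e [:: Some v] = e v.
Proof.
move=> v0; have ts : `|arity v|%N.-tuple (string S) by exact: nseq_tuple [::].
rewrite -(app_literal ts v0) /term_val value_app /=; first by rewrite ifT // v0.
  by rewrite v0.
by case=> j jlt; exfalso; rewrite v0 in jlt.
Qed.

Lemma term_val_app e s (ts : `|arity s|%N.-tuple (string S)) : (0 < arity s)%R ->
  (forall j, is_term (tnth ts j)) -> term_val e (app ts) = fn (map_tuple (term_val e) ts).
Proof.
move=> s0 tst; rewrite /term_val value_app ?ltW //=.
by rewrite gt_eqF.
Qed.

Lemma Sat_equ e t1 t2 : is_term t1 -> is_term t2 ->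
  Sat e (equ t1 t2) <-> term_val e t1 = term_val e t2.
Proof. exact: sat_equ. Qed.

Lemma Sat_rel e r (ts : `|arity r|%N.-tuple (string S)) : (arity r < 0)%R ->
  r <> equality S -> (forall j, is_term (tnth ts j)) ->
  Sat e (app ts) <-> Defs.rel (map_tuple (term_val e) ts).
Proof. exact: sat_rel. Qed.

Lemma Sat_nor e phi psi : is_formula phi -> is_formula psi ->
  Sat e (nor phi psi) <-> ~ Sat e phi /\ ~ Sat e psi.
Proof. exact: sat_nor. Qed.

Lemma Sat_neg e phi : is_formula phi -> Sat e (neg phi) <-> ~ Sat e phi.
Proof. exact: sat_neg. Qed.

Lemma Sat_ex e v phi : literal v -> is_formula phi ->
  Sat e (ex v phi) <-> exists u, Sat (upd e v u) phi.
Proof.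
move=> v0 fphi; rewrite /Sat sat_ex //.
by split=> -[u]; exists u; move: p; rewrite update_with_env.
Qed.

Lemma Sat_atom_congr e e' r (ts ts' : `|arity r|%N.-tuple (string S)) :
  (arity r < 0)%R -> (forall j, is_term (tnth ts j)) ->
  (forall j, is_term (tnth ts' j)) ->
  (forall j, term_val e (tnth ts j) = term_val e' (tnth ts' j)) ->
  Sat e (app ts) <-> Sat e' (app ts').
Proof.
move=> r0 tst ts't eqv; have [rne|eqr] := pselect (r <> equality S).
  rewrite !Sat_rel //; suff -> : map_tuple (term_val e) ts = map_tuple (term_val e') ts' by [].
  by apply: eq_from_tnth => j; rewrite !tnth_map.
move: eqr; rewrite notK => eqr; case: _ / (esym eqr) in ts ts' r0 tst ts't eqv *.
have [t1 [t2 [t1t t2t tsE ->]]] := app_equ tst.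
have [t1' [t2' [t1't t2't ts'E ->]]] := app_equ ts't.
have : map (term_val e) ts = map (term_val e') ts'.
  suff /(congr1 (@tval _ _)) : map_tuple (term_val e) ts = map_tuple (term_val e') ts' by [].
  by apply: eq_from_tnth => j; rewrite !tnth_map.
by rewrite tsE ts'E !Sat_equ // => -[-> ->].
Qed.

Lemma mem_app s (ts : `|arity s|%N.-tuple (string S)) j x :
  x \in tnth ts j -> x \in app ts.
Proof.
move=> xts; rewrite inE; apply/orP; right; apply/flattenP.
by exists (tnth ts j) => //; apply: mem_tnth.
Qed.

Lemma term_val_rename (f : S -> S) e e' t : literal_renaming f -> is_term t ->
  (forall v, literal v -> Some v \in t -> e' v = e (f v)) ->
  term_val e (rename f t) = term_val e' t.
Proof.
move=> fr_; elim=> [v v0|s ts s0 tst IH] eqe.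
  by rewrite !term_val_lit ?eqe ?inE //; apply: fr_.1.
rewrite rename_app //; last exact: not_literal_pos.
rewrite !term_val_app //; last by move=> j; rewrite tnth_map; apply: rename_term.
congr (fn _); apply: eq_from_tnth => j; rewrite !tnth_map; apply: IH => v v0 vj.
exact/eqe/mem_app/vj.
Qed.

(** Injectivity on the symbols of [phi], bound ones included, prevents capture. The lemma is used
    for [id], for [redirect] and for the sparse renaming. *)
Lemma Sat_rename (f : S -> S) e e' phi : literal_renaming f -> is_formula phi ->
  (forall v w, Some v \in phi -> Some w \in phi -> f v = f w -> v = w) ->
  (forall v, literal v -> Some v \in phi -> e' v = e (f v)) ->
  Sat e (rename f phi) <-> Sat e' phi.
Proof.
move=> fr_ fphi; elim: fphi e e' => {phi} [r ts r0 tst|phi psi f1 IH1 f2 IH2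
  |v phi v0 fphi IH] e e' f_inj eqe.
- rewrite rename_app //; last exact: not_literal_neg.
  apply: Sat_atom_congr => // j; rewrite tnth_map; first exact: rename_term.
  by apply: term_val_rename => // v v0 vj; apply/eqe/mem_app/vj.
- rewrite rename_nor // !Sat_nor //; try exact: rename_formula.
  have sub1 x : x \in phi -> x \in nor phi psi by rewrite inE mem_cat => ->; rewrite orbT.
  have sub2 x : x \in psi -> x \in nor phi psi by rewrite inE mem_cat => ->; rewrite !orbT.
  by rewrite (IH1 e e') ?(IH2 e e') //; auto.
- have sub x : x \in phi -> x \in ex v phi by rewrite inE => ->; rewrite orbT.
  rewrite [rename f _]/(ex (f v) (rename f phi)) !Sat_ex //; last 2 first.
  + exact: fr_.1.
  + exact: rename_formula.
  suff E u : Sat (upd e (f v) u) (rename f phi) <-> Sat (upd e' v u) phi.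
    by split=> -[u /E]; exists u.
  apply: IH => [w w' /sub ? /sub ?|w w0 /sub wphi]; first exact: f_inj.
  rewrite /upd; have [->|wv] := eqVneq w v; first by rewrite eqxx.
  (* A collision [f w = f v] would force [w = v]. *)
  have [/f_inj eqw|_] := eqVneq (f w) (f v); last exact: eqe.
  by rewrite eqw ?eqxx // ?inE ?eqxx // in wv.
Qed.

Lemma rename_id phi : rename id phi = phi.
Proof. by rewrite /rename -[RHS]map_id; apply: eq_map => -[]. Qed.

Lemma Sat_coincidence e e' phi : is_formula phi ->
  (forall v, literal v -> Some v \in phi -> e v = e' v) -> Sat e phi <-> Sat e' phi.
Proof.
move=> fphi eqe; rewrite -{1}(rename_id phi); apply: Sat_rename => //.
by move=> v v0 /eqe ->.
Qed.

Lemma term_val_coincidence e e' t : is_term t ->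
  (forall v, literal v -> Some v \in t -> e v = e' v) -> term_val e t = term_val e' t.
Proof.
move=> tt eqe; rewrite -{1}(rename_id t); apply: term_val_rename => //.
by move=> v v0 /eqe ->.
Qed.

Lemma Sat_ssubst e v w phi : literal v -> literal w -> is_formula phi ->
  Some w \notin phi -> Sat e (ssubst v w phi) <-> Sat (upd e v (e w)) phi.
Proof.
move=> v0 w0 fphi wphi; rewrite ssubst_rename; apply: Sat_rename => //.
- exact: redirect_renaming.
- rewrite /redirect => x y xphi yphi.
  have [->|_] := eqVneq x v; have [->|_] := eqVneq y v => //.
  + by move=> eqw; rewrite eqw yphi in wphi.
  + by move=> eqw; rewrite -eqw xphi in wphi.
- by move=> x _ _; rewrite /upd /redirect; case: eqP.
Qed.

Lemma term_val_replace e v t t' : literal v -> is_term t -> is_term t' ->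
  term_val e (replace v t t') = term_val (upd e v (term_val e t)) t'.
Proof.
move=> v0 tt; elim=> [w w0|s ts s0 tst IH].
  rewrite replace_lit term_val_lit // /upd; case: eqP => // _.
  by rewrite term_val_lit.
rewrite replace_app; last by apply/eqP => eqs; rewrite eqs v0 in s0.
rewrite !term_val_app //; last by move=> j; rewrite tnth_map; apply: replace_term.
by congr (fn _); apply: eq_from_tnth => j; rewrite !tnth_map.
Qed.

(** The bound literal is first moved to a fresh [w], so that updating [w] affects neither the value
    of [t] nor that of [v]. *)
Lemma Sat_tsubst e v t phi phi' : literal v -> is_term t ->
  tsubst fr v t phi phi' -> Sat e phi' <-> Sat (upd e v (term_val e t)) phi.
Proof.
move=> v0 tt sub; elim: sub e => {phi phi'} [r ts r0 tst
  |phi psi phi' psi' s1 IH1 s2 IH2|v1 phi phi' v10 sub IH] e.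
- apply: Sat_atom_congr => // j; rewrite tnth_map; first exact: replace_term.
  exact: term_val_replace.
- rewrite !Sat_nor ?IH1 ?IH2 //.
  + exact: tsubst_source s1.
  + exact: tsubst_source s2.
  + exact: tsubst_formula s1.
  + exact: tsubst_formula s2.
- have fphi1 := formula_exP v10 (tsubst_source (tsubst_ex v10 sub)).
  have [] := freshP fr v1 phi v t; set w := fr v1 phi v t => w0 wv wt wphi.
  rewrite !Sat_ex //; last exact: tsubst_formula sub.
  suff E u : Sat (upd e w u) phi' <-> Sat (upd (upd e v (term_val e t)) v1 u) phi.
    by split=> -[u /E]; exists u.
  (* After the rewriting both sides evaluate [phi] itself, in environments that differ at most at
     [w], which [phi] does not contain. *)
  rewrite IH Sat_ssubst //; apply: Sat_coincidence => // x x0 xphi.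
  have xw : x != w by apply: contraNneq wphi => <-.
  have -> : term_val (upd e w u) t = term_val e t.
    apply: term_val_coincidence => // y y0 yt; rewrite /upd ifN //.
    by apply: contraNneq wt => <-.
  by rewrite /upd eqxx (negPf wv) (negPf xw).
Qed.

End Environments.
End Substitution.

(** * The calculus and its soundness *)

Section Calculus.
Variables (S : language) (fr : fresh_choice S).
Implicit Types (s r v : S) (t phi psi chi : string S) (Gam X Y : set (string S)).

Definition stage n : set (sequent S) := iter n (step (D_1 fr)) set0.
Definition prv Gam phi : Prop := exists n, contains (stage n) Gam phi.

Lemma contains_sub (A B : set (sequent S)) Gam phi :
  A `<=` B -> contains A Gam phi -> contains B Gam phi.
Proof. by move=> AB [q /AB Bq qE]; exists q. Qed.

(** Rules in general are arbitrary maps, so this is checked rule by rule: eight rules have no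
    premises and are constant, the bullets treat the other four. *)
Lemma rule_mono (A B : set (sequent S)) (R : rule S) :
  A `<=` B -> D_1 fr R -> R A `<=` R B.
Proof.
move=> AB [[[[[[[[[[[->|->]|->]|->]|->]|->]|->]|->]|->]|->]|->]|->] q //.
- move=> [v [v1 [v2 [psi [Gam [? /(contains_sub AB) ? ? ?]]]]]].
  by exists v, v1, v2, psi, Gam.
- move=> [Gam [phi [psi [? ? /(contains_sub AB) ? /(contains_sub AB) ? ?]]]].
  by exists Gam, phi, psi.
- by move=> [Gam [Gam' [phi [/(contains_sub AB) ? ? ?]]]]; exists Gam, Gam', phi.
- by move=> [Gam [phi [? /(contains_sub AB) ? ?]]]; exists Gam, phi.
Qed.

(** The stages are iterates, not unions, so their inclusion rests on the monotonicity of the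
    rules. *)
Lemma stage_mono m n : (m <= n)%N -> stage m `<=` stage n.
Proof.
have stageS k : stage k `<=` stage k.+1.
  elim: k => [|k IH] q //= [R DR Rq].
  by exists R => //; apply: rule_mono Rq.
by move=> /subnK <-; elim: (n - m)%N => // k /subset_trans; apply.
Qed.

Lemma prv_sequent Gam phi : prv Gam phi -> is_sequent (Gam, phi).
Proof. by move=> [n [[q qP] _ /= <-]]. Qed.

Lemma prv_rule n (R : rule S) Gam phi (H : is_sequent (Gam, phi)) :
  D_1 fr R -> R (stage n) (exist _ _ H) -> prv Gam phi.
Proof. by move=> DR Rq; exists n.+1, (exist _ _ H) => //; exists R. Qed.

Ltac in_D_1 := rewrite /D_1 /=; repeat first [by right | left]; try by [].

Lemma prv_assumption phi : is_formula phi -> prv [set phi] phi.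
Proof.
move=> fphi; have H : is_sequent ([set phi], phi) by split=> /=; [apply: finite_set1|move=> _ ->|].
by apply: (@prv_rule 0 (@R_0 S) _ _ H); [in_D_1|exists phi].
Qed.

Lemma prv_weaken Gam Gam' phi : finite_set Gam' -> Gam' `<=` @is_formula S ->
  Gam `<=` Gam' -> prv Gam phi -> prv Gam' phi.
Proof.
move=> fin' form' sub prvG; have [_ _ fphi] := prv_sequent prvG.
have H : is_sequent (Gam', phi) by split.
have [n Gn] := prvG.
by apply: (@prv_rule n (@R_union S) _ _ H); [in_D_1|exists Gam', Gam, phi].
Qed.

Lemma prv_refl t : is_term t -> prv set0 (equ t t).
Proof.
move=> tt; have H : is_sequent (set0, equ t t).
  by split=> /=; [apply: finite_set0| |apply: formula_equ].
by apply: (@prv_rule 0 (@R_eq S) _ _ H); [in_D_1|exists t].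
Qed.

Lemma prv_sym t1 t2 : is_term t1 -> is_term t2 -> prv [set equ t1 t2] (equ t2 t1).
Proof.
move=> tt1 tt2; have H : is_sequent ([set equ t1 t2], equ t2 t1).
  split=> /=; [exact: finite_set1|move=> _ ->|]; exact: formula_equ.
by apply: (@prv_rule 0 (@R_sym S) _ _ H); [in_D_1|exists t1, t2].
Qed.

Lemma prv_trans t1 t2 t3 : is_term t1 -> is_term t2 -> is_term t3 ->
  prv [set equ t1 t2; equ t2 t3] (equ t1 t3).
Proof.
move=> tt1 tt2 tt3; have H : is_sequent ([set equ t1 t2; equ t2 t3], equ t1 t3).
  split=> /=; [exact: finite_set2|move=> _ [] ->|]; exact: formula_equ.
by apply: (@prv_rule 0 (@R_trans S) _ _ H); [in_D_1|exists t1, t2, t3].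
Qed.

Lemma prv_fun s (ts ts' : `|arity s|%N.-tuple (string S)) : (0 < arity s)%R ->
  (forall j, is_term (tnth ts j)) -> (forall j, is_term (tnth ts' j)) ->
  prv (range (fun j => equ (tnth ts j) (tnth ts' j))) (equ (app ts) (app ts')).
Proof.
move=> s0 tst ts't; have H : is_sequent
    (range (fun j => equ (tnth ts j) (tnth ts' j)), equ (app ts) (app ts')).
  split=> /=; first exact: finite_image.
    by move=> _ [j _ <-]; apply: formula_equ.
  by apply: formula_equ; apply: term_app.
by apply: (@prv_rule 0 (@R_fun S) _ _ H); [in_D_1|exists s, ts, ts'].
Qed.

Lemma prv_rel r (ts ts' : `|arity r|%N.-tuple (string S)) : (arity r < 0)%R ->
  (forall j, is_term (tnth ts j)) -> (forall j, is_term (tnth ts' j)) ->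
  prv (range (fun j => equ (tnth ts j) (tnth ts' j)) `|` [set app ts]) (app ts').
Proof.
move=> r0 tst ts't; have H : is_sequent
    (range (fun j => equ (tnth ts j) (tnth ts' j)) `|` [set app ts], app ts').
  split=> /=; last exact: formula_atom.
    by rewrite finite_setU; split; [exact: finite_image|exact: finite_set1].
  by move=> x [[j _ <-]| ->]; [apply: formula_equ|apply: formula_atom].
by apply: (@prv_rule 0 (@R_rel S) _ _ H); [in_D_1|exists r, ts, ts'].
Qed.

Lemma prv_nor phi1 phi2 phi3 phi4 : is_formula phi1 -> is_formula phi2 ->
  is_formula phi3 -> is_formula phi4 ->
  prv [set nor phi1 phi2; nor phi3 phi4] (nor phi2 phi3).
Proof.
move=> f1 f2 f3 f4.
have H : is_sequent ([set nor phi1 phi2; nor phi3 phi4], nor phi2 phi3).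
  split=> /=; [exact: finite_set2|move=> _ [] ->|]; exact: formula_nor.
by apply: (@prv_rule 0 (@R_nor S) _ _ H); [in_D_1|exists phi1, phi2, phi3, phi4].
Qed.

Lemma prv_ex_right v t psi psi' : literal v -> is_term t -> tsubst fr v t psi psi' ->
  prv [set psi'] (ex v psi).
Proof.
move=> v0 tt sub; have fpsi := tsubst_source sub.
have H : is_sequent ([set psi'], ex v psi).
  split=> /=; [exact: finite_set1|move=> _ ->|]; first exact: tsubst_formula sub.
  exact: formula_ex.
by apply: (@prv_rule 0 (R_ex_right fr) _ _ H); [in_D_1|exists v, t, psi, psi'].
Qed.

(** The only form of conclusion that [R_ex_left] allows; it contradicts [R_eq]. *)
Definition absurd v := neg (equ [:: Some v] [:: Some v]).

Lemma absurd_formula v : literal v -> is_formula (absurd v).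
Proof. by move=> v0; apply/formula_neg/formula_equ; apply: term_lit. Qed.

Lemma prv_ex_left v v1 v2 psi Gam : literal v -> literal v1 -> literal v2 ->
  is_formula psi -> prv (Gam `|` [set ssubst v1 v2 psi]) (absurd v) ->
  (forall chi, (Gam `|` [set psi]) chi -> Some v2 \notin chi) ->
  prv ((Gam `\` [set ssubst v1 v2 psi]) `|` [set ex v1 psi]) (absurd v).
Proof.
move=> v0 v10 v20 fpsi prvG v2G; have [] := prv_sequent prvG.
rewrite /= finite_setU => -[finG _] formG fabs; have [n Gn] := prvG.
have H : is_sequent ((Gam `\` [set ssubst v1 v2 psi]) `|` [set ex v1 psi], absurd v).
  split=> //=; first by rewrite finite_setU; split=> //; apply: finite_setD.
  by move=> x [[? _]|->]; [apply: formG; left|apply: formula_ex].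
by apply: (@prv_rule n (@R_ex_left S) _ _ H); [in_D_1|exists v, v1, v2, psi, Gam].
Qed.

Lemma prv_contr Gam phi psi : is_formula phi -> is_formula psi ->
  prv (Gam `|` [set phi]) psi -> prv (Gam `|` [set phi]) (neg psi) ->
  prv Gam (neg phi).
Proof.
move=> fphi fpsi prv1 prv2; have [] := prv_sequent prv1.
rewrite /= finite_setU => -[finG _] formG _.
have H : is_sequent (Gam, neg phi).
  by split=> //=; [move=> chi ?; apply: formG; left|apply: formula_neg].
have [[m Gm] [n Gn]] := (prv1, prv2).
(* The two premises may appear at different stages; both are present at the larger one. *)
apply: (@prv_rule (maxn m n) (@R_contr S) _ _ H); first by in_D_1.
exists Gam, phi, psi; split=> //.
  exact: contains_sub (stage_mono (leq_maxl _ _)) Gm.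
exact: contains_sub (stage_mono (leq_maxr _ _)) Gn.
Qed.

Lemma prv_negneg Gam phi : is_formula phi -> prv Gam (neg (neg phi)) -> prv Gam phi.
Proof.
move=> fphi prvG; have [finG formG _] := prv_sequent prvG.
have H : is_sequent (Gam, phi) by split.
have [n Gn] := prvG.
by apply: (@prv_rule n (@R_negneg S) _ _ H); [in_D_1|exists Gam, phi].
Qed.

(** The environment is universally quantified in the induction because the case of [R_ex_left] needs
    an updated one. *)
Lemma soundness Gam phi : prv Gam phi ->
  forall (i : interp S) (e : S -> univ i),
  (forall chi, Gam chi -> Sat e chi) -> Sat e phi.
Proof.
move=> [n]; elim: n Gam phi => [|n IH] Gam phi [q] // [R DR Rq] qE i.
have {IH DR Rq qE} := (IH, DR, Rq, qE).
case=> -[[IH [[[[[[[[[[[->|->]|->]|->]|->]|->]|->]|->]|->]|->]|->]|->]]].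
- move=> [psi fpsi ->] [<- <-] e; exact.
- by move=> [t tt ->] [<- <-] e _; rewrite Sat_equ.
- move=> [t1 [t2 [tt1 tt2 ->]]] [<- <-] e /(_ _ erefl).
  by rewrite !Sat_equ.
- move=> [t1 [t2 [t3 [tt1 tt2 tt3 ->]]]] [<- <-] e SatG.
  have := SatG _ (or_introl erefl); have := SatG _ (or_intror erefl).
  by rewrite !Sat_equ // => <- ->.
- move=> [s [ts [ts' [s0 tst ts't ->]]]] [<- <-] e SatG.
  rewrite Sat_equ; try exact: term_app.
  rewrite !term_val_app //; congr (fn _); apply: eq_from_tnth => j.
  rewrite !tnth_map; have := SatG _ (imageT _ j).
  by rewrite Sat_equ.
- move=> [r [ts [ts' [r0 tst ts't ->]]]] [<- <-] e SatG.
  apply/(@Sat_atom_congr _ i e e r ts ts') => //; last by apply: SatG; right.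
  by move=> j; apply/Sat_equ => //; apply: SatG; left; exists j.
- move=> [v [t [psi [psi' [v0 tt fpsi sub ->]]]]] [<- <-] e /(_ _ erefl).
  by rewrite (Sat_tsubst _ v0 tt sub) Sat_ex // => ?; exists (term_val e t).
- move=> [phi1 [phi2 [phi3 [phi4 [f1 f2 f3 f4 ->]]]]] [<- <-] e SatG.
  have := SatG _ (or_introl erefl); have := SatG _ (or_intror erefl).
  by rewrite !Sat_nor // => -[? _] [].
- move=> [v [v1 [v2 [psi [Gam' [[v0 v10 v20 fpsi] cG v2G ->]]]]]] [<- <-] e SatG.
  (* [absurd v] is never true, so the hypotheses must clash. A value [u] witnessing [ex v1 psi] is
     given to the fresh [v2]; this makes the whole antecedent of the premise true, and the induction
     hypothesis would make [absurd v] true. *)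
  exfalso; have [u Satu] : exists u, Sat (upd e v1 u) psi.
    by apply/Sat_ex => //; apply: SatG; right.
  have [_ formG _] : is_sequent (Gam' `|` [set ssubst v1 v2 psi], absurd v).
    by apply: prv_sequent; exists n.
  have vt : is_term [:: Some v] by apply: term_lit.
  have := IH _ _ cG i (upd e v2 u).
  rewrite Sat_neg ?Sat_equ //; last exact: formula_equ.
  apply=> // chi Gchi; have fchi := formG _ Gchi.
  have [->|chine] := pselect (chi = ssubst v1 v2 psi).
    rewrite Sat_ssubst //; last by apply: v2G; right.
    apply: (iffLR _ Satu); apply: Sat_coincidence => // x x0 xpsi.
    rewrite /upd eqxx; case: eqP => // _; case: eqP => // eqx.
    by have := v2G psi (or_intror erefl); rewrite -eqx xpsi.
  (* Any other member of the antecedent is kept by the rule and does not contain [v2], so it stays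
     true. *)
  case: Gchi => // Gchi; have Satchi : Sat e chi by apply: SatG; left.
  apply: (iffLR _ Satchi); apply: Sat_coincidence => // x x0 xchi.
  rewrite /upd; case: eqP => // eqx.
  by have := v2G chi (or_introl Gchi); rewrite -eqx xchi.
- move=> [Gam' [psi [chi [fpsi fchi c1 c2 ->]]]] [<- <-] e SatG.
  rewrite Sat_neg // => Satpsi.
  have SatG' x : (Gam' `|` [set psi]) x -> Sat e x by case=> [/SatG //|->].
  have := IH _ _ c2 i e SatG'; rewrite Sat_neg //; apply.
  exact: (IH _ _ c1 i e SatG').
- move=> [Gam1 [Gam2 [psi [c1 sub ->]]]] [<- <-] e SatG.
  by apply: (IH _ _ c1 i e) => x /sub/SatG.
- move=> [Gam' [psi [fpsi c ->]]] [<- <-] e /(IH _ _ c i e).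
  by rewrite !Sat_neg //; [rewrite notK|apply: formula_neg].
Qed.

End Calculus.

(** * Henkin's construction *)

Section Completeness.
Variables (S : language) (fr : fresh_choice S).
Implicit Types (s r v w : S) (t phi psi chi : string S) (Gam X Y Z : set (string S)).

Lemma derivesP X phi :
  derives (D_1 fr) X phi <-> exists Gam, [/\ finite_set Gam, Gam `<=` X & prv fr Gam phi].
Proof.
split=> [[n [Gam [? ? ?]]]|[Gam [? ? [n ?]]]]; last by exists n, Gam.
by exists Gam; split=> //; exists n.
Qed.

Lemma derives_mono X Y phi : X `<=` Y -> derives (D_1 fr) X phi -> derives (D_1 fr) Y phi.
Proof. by move=> XY [n [Gam [? GX ?]]]; exists n, Gam; split=> // ? /GX/XY. Qed.

Lemma derives_assumption X phi : X phi -> is_formula phi -> derives (D_1 fr) X phi.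
Proof.
move=> Xphi fphi; apply/derivesP; exists [set phi]; split; first exact: finite_set1.
  by move=> _ ->.
exact: prv_assumption.
Qed.

Lemma derives_formula X phi : derives (D_1 fr) X phi -> is_formula phi.
Proof. by move=> /derivesP[Gam [_ _ /prv_sequent[]]]. Qed.

Definition consistent X : Prop :=
  forall psi, derives (D_1 fr) X psi -> derives (D_1 fr) X (neg psi) -> False.

Lemma consistent_sub X Y : X `<=` Y -> consistent Y -> consistent X.
Proof. by move=> XY consY psi d1 d2; apply: (consY psi); apply: derives_mono XY _. Qed.

Lemma inconsistent X : ~ consistent X ->
  exists2 psi, derives (D_1 fr) X psi & derives (D_1 fr) X (neg psi).
Proof.
move=> ncons; apply: contrapT => ne; apply: ncons => psi d1 d2.
by apply: ne; exists psi.
Qed.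

Lemma derives_neg X phi : is_formula phi -> ~ consistent (X `|` [set phi]) ->
  derives (D_1 fr) X (neg phi).
Proof.
move=> fphi /inconsistent[psi d1 d2]; have fpsi := derives_formula d1.
have [G1 [fin1 sub1 prv1]] := (derivesP _ _).1 d1.
have [G2 [fin2 sub2 prv2]] := (derivesP _ _).1 d2.
have [_ form1 _] := prv_sequent prv1; have [_ form2 _] := prv_sequent prv2.
(* [phi] is removed so that the antecedent lies in [X]; [R_contr] wants it as the added formula. *)
pose Gam := (G1 `|` G2) `\` [set phi].
have finG : finite_set Gam by apply: finite_setD; rewrite finite_setU.
have finG' : finite_set (Gam `|` [set phi]).
  by rewrite finite_setU; split=> //; apply: finite_set1.
have formG : Gam `|` [set phi] `<=` @is_formula S.
  by move=> chi [[[/form1|/form2]]|->].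
apply/derivesP; exists Gam; split=> //.
  by move=> chi [[/sub1|/sub2] []].
have sub chi : (G1 `|` G2) chi -> (Gam `|` [set phi]) chi.
  by move=> ?; have [->|] := pselect (chi = phi); [right|left].
apply: (prv_contr fphi fpsi).
  by apply: prv_weaken prv1 => // chi ?; apply: sub; left.
by apply: prv_weaken prv2 => // chi ?; apply: sub; right.
Qed.

Lemma derives_negneg X phi : is_formula phi ->
  derives (D_1 fr) X (neg (neg phi)) -> derives (D_1 fr) X phi.
Proof.
move=> fphi /derivesP[Gam [? ? /(prv_negneg fphi) ?]].
by apply/derivesP; exists Gam.
Qed.

Lemma derives_refutation X phi : is_formula phi ->
  ~ consistent (X `|` [set neg phi]) -> derives (D_1 fr) X phi.
Proof.
by move=> fphi /(derives_neg (formula_neg fphi)); apply: derives_negneg.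
Qed.

Lemma explosion X phi : is_formula phi -> ~ consistent X -> derives (D_1 fr) X phi.
Proof.
move=> fphi ncons; apply: derives_refutation => // cons; apply: ncons.
by apply: consistent_sub cons => ? ?; left.
Qed.

Lemma derives_refl X t : is_term t -> derives (D_1 fr) X (equ t t).
Proof.
move=> tt; apply/derivesP; exists set0.
by split; [exact: finite_set0| |exact: prv_refl].
Qed.

Lemma literals_not_finite (A : set S) : finite_set A -> exists2 v, literal v & ~ A v.
Proof.
move=> finA; apply: contrapT => ne; apply: (@literals_infinite S).
apply: sub_finite_set finA => v /= v0; apply: contrapT => nAv.
by apply: ne; exists v.
Qed.

(** If the instance made the set inconsistent, [absurd v] would be derivable; [R_ex_left] would
    trade the instance for [ex v psi], which is already present, and [absurd v] contradicts
    reflexivity. *)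
Lemma consistent_witness X v w psi : literal v -> literal w ->
  is_formula psi -> consistent (X `|` [set ex v psi]) ->
  (forall chi, (X `|` [set ex v psi]) chi -> Some w \notin chi) ->
  consistent (X `|` [set ex v psi] `|` [set ssubst v w psi]).
Proof.
move=> v0 w0 fpsi cons wfresh; apply: contrapT => ncons; apply: (cons).
  exact/derives_refl/(term_lit v0).
have := explosion (absurd_formula v0) ncons.
move=> /derivesP[Gam [finG subG prvG]]; apply/derivesP.
have [_ formG _] := prv_sequent prvG.
(* The instance may contain [w], so it is taken out before freshness is checked; the second removal
   below is the one built into [R_ex_left]. *)
pose G' := Gam `\` [set ssubst v w psi].
exists ((G' `\` [set ssubst v w psi]) `|` [set ex v psi]); split.
- rewrite finite_setU; split; last exact: finite_set1.
  by do 2 apply: finite_setD.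
- by move=> chi [[[/subG[//|->]] []]|->] //; right.
apply: prv_ex_left => //.
  apply: prv_weaken prvG.
  + rewrite finite_setU; split; last exact: finite_set1.
    exact: finite_setD.
  + move=> chi [[/formG]//|->]; exact: ssubst_formula.
  + by move=> chi ?; have [->|] := pselect (chi = ssubst v w psi); [right|left].
move=> chi [[/subG[/wfresh //|->] []]|->] //.
have := wfresh _ (or_intror erefl).
by rewrite inE negb_or => /andP[].
Qed.

(** The witness must not occur in [psi] so that [Sat_ssubst] can evaluate the instance. *)
Record henkin Z : Prop := Henkin {
  henkin_formula : Z `<=` @is_formula S;
  henkin_consistent : consistent Z;
  henkin_max : forall phi, is_formula phi -> consistent (Z `|` [set phi]) -> Z phi;
  henkin_witness : forall v psi, literal v -> Z (ex v psi) ->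
    exists w, [/\ literal w, Some w \notin psi & Z (ssubst v w psi)]
}.

(** * The term model *)

Section TermModel.
Variables (Z : set (string S)) (hZ : henkin Z).

Lemma henkin_closed phi : derives (D_1 fr) Z phi -> Z phi.
Proof.
move=> d; have fphi := derives_formula d.
apply: henkin_max => //; apply: contrapT => /(derives_neg fphi) d'.
exact: henkin_consistent d d'.
Qed.

Lemma henkin_prv Gam phi : Gam `<=` Z -> prv fr Gam phi -> Z phi.
Proof.
move=> GZ prvG; apply: henkin_closed; apply/derivesP; exists Gam; split=> //.
by have [] := prv_sequent prvG.
Qed.

Lemma henkin_neg phi : is_formula phi -> Z (neg phi) <-> ~ Z phi.
Proof.
move=> fphi; split=> [Zn Zphi|nZ].
  apply: (henkin_consistent hZ (psi := phi)); apply: derives_assumption => //.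
  exact: formula_neg.
by apply/henkin_closed/derives_neg => // /(henkin_max hZ fphi).
Qed.

Lemma henkin_nor phi psi : is_formula phi -> is_formula psi ->
  Z (nor phi psi) <-> ~ Z phi /\ ~ Z psi.
Proof.
move=> f1 f2; rewrite -!henkin_neg //.
(* Applied to [nor phi psi] twice, the rule swaps the arguments; the swapped copy and the original
   give [neg phi] and [neg psi]. The converse is one application to the two negations. *)
have nor_rule a b c d : is_formula a -> is_formula b -> is_formula c ->
    is_formula d -> Z (nor a b) -> Z (nor c d) -> Z (nor b c).
  by move=> fa fb fc fd ? ?; apply: henkin_prv (prv_nor fr fa fb fc fd) => _ [] ->.
split=> [Z1|[Z1 Z2]]; last exact: (nor_rule _ _ _ _ _ _ _ _ Z1 Z2).
have Z2 : Z (nor psi phi) by apply: (nor_rule _ _ _ _ _ _ _ _ Z1 Z1).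
by split; [apply: (nor_rule _ _ _ _ _ _ _ _ Z2 Z1)|apply: (nor_rule _ _ _ _ _ _ _ _ Z1 Z2)].
Qed.

Lemma henkin_refl t : is_term t -> Z (equ t t).
Proof. by move=> tt; apply/henkin_closed/derives_refl. Qed.

Lemma henkin_sym t t' : is_term t -> is_term t' -> Z (equ t t') -> Z (equ t' t).
Proof. by move=> tt t't Ze; apply: henkin_prv (prv_sym fr tt t't) => _ ->. Qed.

Lemma henkin_trans t1 t2 t3 : is_term t1 -> is_term t2 -> is_term t3 ->
  Z (equ t1 t2) -> Z (equ t2 t3) -> Z (equ t1 t3).
Proof.
by move=> tt1 tt2 tt3 ? ?; apply: henkin_prv (prv_trans fr tt1 tt2 tt3) => _ [] ->.
Qed.

Lemma henkin_fun s (ts ts' : `|arity s|%N.-tuple (string S)) : (0 < arity s)%R ->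
  (forall j, is_term (tnth ts j)) -> (forall j, is_term (tnth ts' j)) ->
  (forall j, Z (equ (tnth ts j) (tnth ts' j))) -> Z (equ (app ts) (app ts')).
Proof.
by move=> s0 tst ts't Ze; apply: henkin_prv (prv_fun fr s0 tst ts't) => _ [j _ <-].
Qed.

Lemma henkin_rel r (ts ts' : `|arity r|%N.-tuple (string S)) : (arity r < 0)%R ->
  (forall j, is_term (tnth ts j)) -> (forall j, is_term (tnth ts' j)) ->
  (forall j, Z (equ (tnth ts j) (tnth ts' j))) -> Z (app ts) -> Z (app ts').
Proof.
move=> r0 tst ts't Ze Zts; apply: henkin_prv (prv_rel fr r0 tst ts't).
by move=> x [[j _ <-]|->].
Qed.

(** Terms modulo the equations in [Z], realized by chosen representatives: the universe consists of
    the strings [norm t]. *)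
Lemma term_quotient : exists (U : Type) (cls : string S -> U) (rep : U -> string S),
  [/\ forall u, is_term (rep u), forall u, cls (rep u) = u &
      forall t t', is_term t -> is_term t' -> cls t = cls t' <-> Z (equ t t')].
Proof.
have [z z0 _] := literals_not_finite (@finite_set0 S).
(* A default literal in place of strings that are not terms makes [cls] total. *)
pose base t := if pselect (is_term t) then t else [:: Some z].
have base_term t : is_term (base t).
  by rewrite /base; case: pselect => [t_term|not_term]; last exact: term_lit.
have baseE t : is_term t -> base t = t by rewrite /base; case: pselect.
(* One choice function serves all sets, so the string picked depends only on the class and not on
   the term that names it. *)
have ex_norm (C : set (string S)) : exists x, forall t, C t -> C x.
  have [[x Cx]|nC] := pselect (exists x, C x); first by exists x.
  by exists [::] => t Ct; case: nC; exists t.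
have [pick pickP] := choice ex_norm.
pose cl t := [set t' | is_term t' /\ Z (equ (base t) t')].
pose norm t := pick (cl t).
have normP t : is_term (norm t) /\ Z (equ (base t) (norm t)).
  by apply: (pickP (cl t) (base t)); split=> //; apply: henkin_refl.
have eq_norm t t' : norm t = norm t' <-> Z (equ (base t) (base t')).
  have [[nt ?] [nt' ?]] := (normP t, normP t'); split=> [eqn|Ze].
    apply: henkin_trans (nt) _ _ _ => //.
    by rewrite eqn; apply: henkin_sym.
  congr pick; apply/seteqP; split=> x [xt Zx]; split=> //.
    by apply: henkin_trans (base_term t) _ _ _ => //; apply: henkin_sym.
  by apply: henkin_trans (base_term t') _ _ _.
exists {x | exists t, x = norm t}, (fun t => exist _ (norm t) (ex_intro _ t erefl)), sval.
split=> [[x [t xE]]|[x [t xE]]|t t' tt t't] /=.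
- by rewrite xE; case: (normP t).
- apply: eq_exist; rewrite xE; apply/eq_norm; have [nt Zn] := normP t.
  by rewrite (baseE _ nt); apply: henkin_sym.
- have := eq_norm t t'; rewrite !baseE // => <-.
  by split=> [[]//|eqn]; apply: eq_exist.
Qed.

(** The induction is on rank: an instance of the body of a quantified formula is no subformula, but
    its rank bound is smaller. *)
Lemma term_model : exists (i : interp S) (e : S -> univ i),
  forall phi, is_formula phi -> Sat e phi <-> Z phi.
Proof.
have [U [cls [rep [rep_term clsK cls_eq]]]] := term_quotient.
pose i := @Interp S U (inhabits (cls [::])) (fun s us => cls (app (map_tuple rep us)))
  (fun r us => `[< Z (app (map_tuple rep us)) >]).
pose e v : univ i := cls [:: Some v].
have repK t : is_term t -> Z (equ (rep (cls t)) t) by move=> tt; apply/cls_eq.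
have valE t : is_term t -> term_val e t = cls t.
  elim=> [v v0|s ts s0 tst IH]; first by rewrite term_val_lit.
  rewrite term_val_app //=; apply/cls_eq.
  - by apply: term_app => // j; rewrite tnth_map.
  - exact: term_app.
  apply: henkin_fun => // j; rewrite !tnth_map //.
  by rewrite IH; apply: repK.
exists i, e => phi /formula_rank[n]; have [m] := ubnP n.
elim: m n phi => // m IH n phi ltnm rphi.
case: rphi ltnm => {n phi} [n r ts r0 tst _|n phi psi r1 r2 ltnm|n v phi v0 r1 ltnm].
- have [rne|[t1 [t2 [t1t t2t ->]]]] := atom_cases tst; last first.
    by rewrite Sat_equ // !valE // cls_eq.
  rewrite Sat_rel //=; set us := map_tuple rep _.
  have usE j : tnth us j = rep (cls (tnth ts j)) by rewrite !tnth_map valE.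
  have ust j : is_term (tnth us j) by rewrite usE.
  split=> [/asboolP|Zts]; last apply/asboolP.
    by apply: henkin_rel => // j; rewrite usE; apply: repK.
  apply: henkin_rel Zts => // j; rewrite usE.
  by apply: henkin_sym => //; apply: repK.
- have [fphi fpsi] := (rank_formula r1, rank_formula r2).
  by rewrite Sat_nor // henkin_nor // (IH _ _ ltnm r1) (IH _ _ ltnm r2).
- have fphi := rank_formula r1; rewrite Sat_ex //; split=> [[u]|].
    (* Every element [u] is the value of the term [rep u], so truth of the body at [u] is truth of a
       term instance, to which the induction hypothesis and [R_ex_right] apply. *)
    have ut := rep_term u; have [phi' sub r'] := tsubst_total fr v0 ut r1.
    rewrite -[u]clsK -(valE _ ut) -(Sat_tsubst _ v0 ut sub) (IH _ _ ltnm r') => Z'.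
    by apply: henkin_prv (prv_ex_right v0 ut sub) => _ ->.
  move=> /(henkin_witness hZ v0)[w [w0 wphi]].
  rewrite -(IH _ _ ltnm (rank_ssubst v0 w0 r1)) Sat_ssubst // => Satphi.
  by exists (e w).
Qed.

End TermModel.

(** * Extension to a Henkin set *)

Definition unused X : set S :=
  [set v | literal v /\ forall chi, X chi -> Some v \notin chi].

Lemma unused_finite X Gam : finite_set Gam -> infinite_set (unused X) ->
  infinite_set (unused (X `|` Gam)).
Proof.
move=> finG infX finXG; apply: infX.
pose used := \bigcup_(chi in Gam) [set v : S | Some v \in chi].
apply: (@sub_finite_set _ _ (unused (X `|` Gam) `|` used)).
  move=> v [v0 vX]; have [vG|nvG] := pselect (used v); first by right.
  left; split=> // chi [/vX //|Gchi]; apply/negP => vchi.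
  by apply: nvG; exists chi.
rewrite finite_setU; split=> //; apply: bigcup_finite => // chi _.
apply: (sub_finite_set _ (finite_seq (pmap id chi))) => v /=.
by rewrite mem_pmap map_id.
Qed.

(** The invariant of the construction: a fresh witness is always available. *)
Definition extendable X : Prop :=
  [/\ X `<=` @is_formula S, consistent X & infinite_set (unused X)].

Lemma extend X phi : extendable X -> exists Y, [/\ extendable Y, X `<=` Y &
  is_formula phi -> consistent (X `|` [set phi]) -> Y phi /\
    forall v psi, literal v -> phi = ex v psi ->
    exists w, [/\ literal w, Some w \notin psi & Y (ssubst v w psi)]].
Proof.
move=> gX; have [formX consX infX] := gX.
have [[fphi consphi]|nphi] := pselect (is_formula phi /\ consistent (X `|` [set phi])); last first.
  by exists X; split=> // ? ?; case: nphi.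
have formX' : X `|` [set phi] `<=` @is_formula S by move=> chi [/formX|->].
have infX' : infinite_set (unused (X `|` [set phi])).
  exact: (unused_finite (finite_set1 _)).
have [[v [psi [v0 phiE]]]|nex] := pselect (exists v psi, literal v /\ phi = ex v psi); last first.
  exists (X `|` [set phi]); split; [by split|by move=> ? ?; left|].
  move=> _ _; split; first by right.
  by move=> v psi v0 phiE; case: nex; exists v, psi.
have fpsi : is_formula psi by apply: (formula_exP v0); rewrite -phiE.
have [w [w0 wfresh]] : exists w, unused (X `|` [set phi]) w.
  apply: contrapT => ne; apply: infX'; apply: sub_finite_set (@finite_set0 S) => w uw.
  by apply: ne; exists w.
have wpsi : Some w \notin psi.
  by have := wfresh phi (or_intror erefl); rewrite phiE inE negb_or => /andP[].
exists (X `|` [set phi] `|` [set ssubst v w psi]); split.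
- split; last exact: (unused_finite (finite_set1 _)).
    by move=> chi [/formX'//|->]; apply: ssubst_formula.
  by subst phi; apply: consistent_witness.
- by move=> ? ?; left; left.
- move=> _ _; split; first by left; right.
  move=> v' psi' v'0; rewrite phiE => -[<- <-].
  by exists w; split=> //; right.
Qed.

Lemma finite_sub_chain (T : eqType) (A : set T) (F : nat -> set T) :
  (forall m n, (m <= n)%N -> F m `<=` F n) -> finite_set A ->
  A `<=` \bigcup_n F n -> exists n, A `<=` F n.
Proof.
move=> Fmono /finite_seqP[l ->]; elim: l => [_|x l IH sub]; first by exists 0.
have [y /= yl|n ln] := IH; first by apply: sub; rewrite /= inE yl orbT.
have [m _ Fx] := sub x (mem_head _ _).
exists (maxn m n) => y /=; rewrite inE => /predU1P[->|/ln].
  exact: Fmono (leq_maxl _ _) _ Fx.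
exact: Fmono (leq_maxr _ _) _.
Qed.

Lemma lindenbaum (code : string S -> nat) X : injective code -> extendable X ->
  exists2 Z, henkin Z & X `<=` Z.
Proof.
move=> code_inj gX.
(* A left inverse of [code]; numbers that code nothing go to the empty string. *)
have [dec decP] : exists dec, forall phi, dec (code phi) = phi.
  have [n|dec decP] := @choice nat (string S) (fun n psi => forall phi, code phi = n -> psi = phi).
    have [[phi <-]|ne] := pselect (exists phi, code phi = n).
      by exists phi => psi /code_inj.
    by exists [::] => phi eqn; case: ne; exists phi.
  by exists dec => phi; apply: decP.
(* Extendability is a premise here so that [choice] gives a function on all pairs. *)
pose extends (p : set (string S) * string S) Y := extendable p.1 ->
  [/\ extendable Y, p.1 `<=` Y &
    is_formula p.2 -> consistent (p.1 `|` [set p.2]) -> Y p.2 /\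
    forall v psi, literal v -> p.2 = ex v psi ->
    exists w, [/\ literal w, Some w \notin psi & Y (ssubst v w psi)]].
have [[Y phi]|f fP] := @choice _ _ extends.
  rewrite /extends /=.
  have [gY|ngY] := pselect (extendable Y); last by exists Y.
  by have [Y' ?] := extend phi gY; exists Y'.
pose F := fix F n := if n is n'.+1 then f (F n', dec n') else X.
have gF n : extendable (F n) by elim: n => // n /(fP (F n, dec n))[].
have Fmono m n : (m <= n)%N -> F m `<=` F n.
  move=> /subnK <-; elim: (n - m)%N => // k IH x /IH.
  by have [_ sub _] := fP (F (k + m), dec (k + m)) (gF _); apply: sub.
pose Z := \bigcup_n F n.
(* [phi] is treated at stage [code phi]; consistent with the union [Z], it is consistent with that
   stage. *)
have Zmax phi : is_formula phi -> consistent (Z `|` [set phi]) -> Z phi /\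
    forall v psi, literal v -> phi = ex v psi ->
    exists w, [/\ literal w, Some w \notin psi & Z (ssubst v w psi)].
  move=> fphi consphi; pose n := code phi.
  have [|_ _] := fP (F n, dec n); first exact: gF.
  rewrite /= decP => -[] //.
    apply: consistent_sub consphi => chi [Fchi|->]; last by right.
    by left; exists n.
  move=> Fphi wit; split; first by exists n.+1 => //=; rewrite decP.
  move=> v psi v0 /(wit _ _ v0)[w [w0 wpsi Fw]]; exists w; split=> //.
  by exists n.+1 => //=; rewrite decP.
(* A contradiction uses finitely many premises, which lie together in one [F n]. *)
have consZ : consistent Z.
  move=> psi /derivesP[G1 [fin1 sub1 prv1]] /derivesP[G2 [fin2 sub2 prv2]].
  have [||n subn] := @finite_sub_chain _ (G1 `|` G2) F Fmono.
  - by rewrite finite_setU.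
  - by move=> chi [/sub1|/sub2].
  have [_ consn _] := gF n.
  apply: (consn psi); apply/derivesP; [exists G1|exists G2]; split=> // chi ?;
    apply: subn; by [left|right].
have formZ : Z `<=` @is_formula S by move=> chi [n _]; have [+ _ _] := gF n; apply.
exists Z; last by move=> chi ?; exists 0.
split=> // [phi fphi /(Zmax _ fphi)[]//|v psi v0 Zex].
have [||_] := Zmax (ex v psi); first exact: formZ.
  by apply: consistent_sub consZ => chi [|->].
by apply.
Qed.

Lemma satisfiable (code : string S -> nat) X : injective code -> extendable X ->
  exists (i : interp S) (e : S -> univ i), forall phi, X phi -> Sat e phi.
Proof.
move=> code_inj gX; have [formX _ _] := gX.
have [Z hZ XZ] := lindenbaum code_inj gX.
have [i [e SatZ]] := term_model hZ.
by exists i, e => phi Xphi; apply/SatZ; [apply: formX|apply: XZ].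
Qed.

Lemma satisfiable_finite (code : string S -> nat) X : injective code ->
  finite_set X -> X `<=` @is_formula S -> consistent X ->
  exists (i : interp S) (e : S -> univ i), forall phi, X phi -> Sat e phi.
Proof.
move=> code_inj finX formX consX; apply: (satisfiable code_inj); split=> //.
rewrite -[X]set0U; apply: unused_finite => // fin0.
by apply: (@literals_infinite S); apply: sub_finite_set fin0 => v.
Qed.

(** The two derivations of a contradiction use finitely many premises; by soundness a model of these
    would satisfy both [psi] and [neg psi]. *)
Lemma consistent_satisfiable X :
  (forall Gam, finite_set Gam -> Gam `<=` X ->
    exists (i : interp S) (e : S -> univ i), forall phi, Gam phi -> Sat e phi) ->
  consistent X.
Proof.
move=> satX psi d1 d2; have fpsi := derives_formula d1.
have [G1 [fin1 sub1 prv1]] := (derivesP _ _).1 d1.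
have [G2 [fin2 sub2 prv2]] := (derivesP _ _).1 d2.
have [||i [e SatG]] := satX (G1 `|` G2); first by rewrite finite_setU.
  by move=> chi [/sub1|/sub2].
have : Sat e (neg psi) by apply: (soundness prv2) => chi ?; apply: SatG; right.
rewrite Sat_neg //; apply; apply: (soundness prv1) => chi ?; apply: SatG; by left.
Qed.

End Completeness.

(** * Sparse renamings and completeness *)

Lemma countable_string_code (S : language) : countable [set: symbol S] ->
  exists2 code : string S -> nat, injective code &
  exists c : S -> nat, injective c.
Proof.
move=> /countable_injP[f f_inj].
have finj : injective f by move=> x y; apply: f_inj; rewrite inE.
exists (fun phi => pickle (map f phi)).
  by move=> x y /(pcan_inj pickleK)/(inj_map finj).
by exists (f \o some) => x y /finj[].
Qed.

(** An injection [g] of the naturals into the literals is used at even indices only, so the literals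
    at odd indices are missed. *)
Lemma sparse_renaming (S : language) (c : S -> nat) : injective c ->
  exists2 f : S -> S, literal_renaming f /\ injective f &
    infinite_set [set v | literal v /\ forall s, f s <> v].
Proof.
move=> c_inj; have /infiniteP/card_leP/unsquash g0 := @literals_infinite S.
pose g n : S := set_val (g0 (to_setT n)).
have g_lit n : literal (g n) by apply: set_valP.
have g_inj : injective g.
  by move=> m n /val_inj/(inj (in_setT _) (in_setT _))/(congr1 set_val).
pose f s := if pselect (literal s) then g (c s).*2 else s.
have f_lit s : literal s -> f s = g (c s).*2 by rewrite /f; case: pselect.
have f_nlit s : ~ literal s -> f s = s by rewrite /f; case: pselect.
exists f.
  split; first by split=> // v v0; rewrite f_lit.
  move=> s s'; have [l|nl] := pselect (literal s); have [l'|nl'] := pselect (literal s').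
  - by rewrite !f_lit // => /g_inj/double_inj/c_inj.
  - by rewrite (f_lit _ l) (f_nlit _ nl') => eqs; case: nl'; rewrite -eqs.
  - by rewrite (f_nlit _ nl) (f_lit _ l') => eqs; case: nl; rewrite eqs.
  - by rewrite !f_nlit.
have odd_inj : injective (fun n => g n.*2.+1) by move=> m n /g_inj[]/double_inj.
(* If the missed literals were finitely many, so would be the odd indices, hence the naturals. *)
move=> finf; apply: infinite_nat.
apply: (sub_finite_set _ (finite_preimage (in2W odd_inj) finf)) => n _.
split=> //= s eqg.
have [l|nl] := pselect (literal s).
  by move: eqg; rewrite f_lit // => /g_inj/(congr1 odd); rewrite /= !odd_double.
by apply: (nl); rewrite -(f_nlit _ nl) eqg.
Qed.

Theorem mainTheorem1 (S : language) (fr : fresh_choice S)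
  (S_countable : countable [set: symbol S])
  (X : set (string S)) (X_formulas : forall psi, X psi -> is_formula psi)
  (phi : string S) (phi_formula : is_formula phi) :
  entails X phi -> derives (D_1 fr) X phi.
Proof.
move=> X_phi; apply: derives_refutation => // consX.
set Y := X `|` [set neg phi] in consX.
have formY : Y `<=` @is_formula S.
  by move=> psi [/X_formulas|->] //; apply: formula_neg.
have [code code_inj [c c_inj]] := countable_string_code S_countable.
have [f [f_ren f_inj] inff] := sparse_renaming c_inj.
have Sat_f (i : interp S) (e e' : S -> univ i) psi : is_formula psi ->
    (forall v, e' v = e (f v)) -> Sat e (rename f psi) <-> Sat e' psi.
  by move=> fpsi eqe; apply: Sat_rename => // v w _ _ /f_inj.
have formfY : rename f @` Y `<=` @is_formula S.
  by move=> _ [psi /formY fpsi <-]; apply: rename_formula.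
have consfY : consistent fr (rename f @` Y).
  apply: consistent_satisfiable => Gam finG subG.
  (* [g] chooses a preimage in [Y] for each renamed formula, so that [Gam] comes from a finite part
     of [Y]. *)
  have [psi|g gP] := @choice (string S) (string S)
      (fun psi chi => (rename f @` Y) psi -> Y chi /\ rename f chi = psi).
    have [[chi Ychi eqchi]|npsi] := pselect ((rename f @` Y) psi).
      by exists chi.
    by exists psi => /npsi.
  have subY : g @` Gam `<=` Y by move=> _ [psi /subG/gP[? _] <-].
  have [||i [e SatG]] := @satisfiable_finite S fr code (g @` Gam) code_inj (finite_image g finG).
  - by move=> psi /subY/formY.
  - exact: consistent_sub consX.
  (* A left inverse of [f], arbitrary off its range: the environment [e \o h] gives [f v] the value
     [e v]. *)
  have [h hP] : exists h : S -> S, forall v, h (f v) = v.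
    have [s|h hP] := @choice S S (fun s v => forall w, f w = s -> v = w).
      have [[w <-]|nw] := pselect (exists w, f w = s).
        by exists w => v /f_inj.
      by exists s => w eqw; case: nw; exists w.
    by exists h => v; apply: hP.
  exists i, (e \o h) => psi Gpsi; have [Ypsi <-] := gP _ (subG _ Gpsi).
  apply/(@Sat_f i (e \o h) e); first exact: formY.
    by move=> v /=; rewrite hP.
  by apply: SatG; exists psi.
have [|i [e SatfY]] := @satisfiable S fr code (rename f @` Y) code_inj.
  split=> // finU; apply: inff; apply: sub_finite_set finU => v [v0 nfv].
  split=> // _ [psi _ <-]; apply/negP => /mapP[[s|//] _ [eqv]].
  by apply: (nfv s).
have SatY psi : Y psi -> Sat (e \o f) psi.
  move=> Ypsi; apply/(@Sat_f i e); [exact: formY|by []|].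
  by apply: SatfY; exists psi.
have /Sat_neg : Sat (e \o f) (neg phi) by apply: SatY; right.
(* [X_phi] is applied to the interpretation [with_env (e \o f)]. *)
by apply=> //; apply: X_phi => psi Xpsi; apply: SatY; left.
Qed.
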